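(* The optimal growth rates $\mu_{\mathrm{can}}$ of cancellative pairs and $\mu_{\mathrm{rec}}$ of recovering pairs satisfy $$\mu_{\mathrm{rec}} < 2.25 = \mu_{\mathrm{can}}.$$
   Context: Here $[n]=\{1,\dots,n\}$. A pair $(\mathcal{A}, \mathcal{B})$ of families of subsets of $[n]$ is called cancellative if both of the following hold: (i) whenever $A, A' \in \mathcal{A}$ and $B \in \mathcal{B}$ satisfy $A \cup B=A' \cup B$, then $A=A'$; (ii) whenever $A \in \mathcal{A}$ and $B, B' \in \mathcal{B}$ satisfy $A \cup B=A \cup B'$, then $B=B'$. A pair $(\mathcal{A}, \mathcal{B})$ of families of subsets of $[n]$ is called recovering if for all $A, A' \in \mathcal{A}$ and $B, B' \in \mathcal{B}$: $A \setminus B=A'\setminus B'$ implies $A=A'$, and $B \setminus A=B' \setminus A'$ implies $B=B'$. The optimal growth rates are $$\mu_{\mathrm{can}}=\lim_{n \rightarrow \infty} \left(\max_{(\mathcal{A}, \mathcal{B}) \text{ cancellative on } [n]} |\mathcal{A}||\mathcal{B}|\right)^{1/n},\qquad \mu_{\mathrm{rec}}=\lim_{n \rightarrow \infty} \left(\max_{(\mathcal{A}, \mathcal{B}) \text{ recovering on } [n]} |\mathcal{A}||\mathcal{B}|\right)^{1/n},$$ where the maxima are over all pairs of families of subsets of $[n]$ that are cancellative, respectively recovering. *)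

(* Defs.v *)
From mathcomp Require Import all_boot all_order all_algebra.
From mathcomp Require Import all_classical all_reals all_analysis.
Set Implicit Arguments.
Unset Strict Implicit.
Unset Printing Implicit Defensive.
Import Order.TTheory GRing.Theory Num.Theory.
Import numFieldNormedType.Exports.
Local Open Scope ring_scope.

(* The ground set [n] = {1, ..., n} is represented by 'I_n. *)
Definition cancellative (n : nat) (FA FB : {set {set 'I_n}}) : bool :=
  [forall A in FA, forall A' in FA, forall B in FB,
     (A :|: B == A' :|: B) ==> (A == A')] &&
  [forall A in FA, forall B in FB, forall B' in FB,
     (A :|: B == A :|: B') ==> (B == B')].

Definition recovering (n : nat) (FA FB : {set {set 'I_n}}) : bool :=
  [forall A in FA, forall A' in FA, forall B in FB, forall B' in FB,
     ((A :\: B == A' :\: B') ==> (A == A')) &&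
     ((B :\: A == B' :\: A') ==> (B == B'))].

(* The empty pair is cancellative and recovering, so the default value 0 of
   \max over an empty range plays no role. *)
Definition max_can (n : nat) : nat :=
  (\max_(P : {set {set 'I_n}} * {set {set 'I_n}} | cancellative P.1 P.2)
     (#|P.1| * #|P.2|))%N.

Definition max_rec (n : nat) : nat :=
  (\max_(P : {set {set 'I_n}} * {set {set 'I_n}} | recovering P.1 P.2)
     (#|P.1| * #|P.2|))%N.

(* The n-th root is the real power of exponent n^-1; the value at n = 0 is
   irrelevant to the limit. *)
Definition can_rate (R : realType) (n : nat) : R :=
  (max_can n)%:R `^ n%:R^-1.

Definition rec_rate (R : realType) (n : nat) : R :=
  (max_rec n)%:R `^ n%:R^-1.

(* limn returns an arbitrary value on a divergent sequence, so these are
   meaningful only together with the convergence of the rates. *)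
Definition mu_can (R : realType) : R := limn (@can_rate R).

Definition mu_rec (R : realType) : R := limn (@rec_rate R).

(* Main.v *)
Require Import Defs.
From mathcomp Require Import all_boot all_order all_algebra.
From mathcomp Require Import all_classical all_reals all_analysis.
From mathcomp Require Import zify ring lra.
Import Order.TTheory GRing.Theory Num.Theory.
Import numFieldNormedType.Exports.
Local Open Scope ring_scope.

(** Upper bound for cancellative pairs.  Weigh a set A inside a ground set S by
    the product of x_i over the i in S outside A, and B by the product of the
    1 - x_i over the i in S outside B.  Then the total weights of the two
    families multiply to at most 1.  Indeed A is determined by A \ B once B is
    given, so Kraft's inequality holds for the product measure on S \ B with
    densities 1 - x_i, and symmetrically for B with densities x_i; the two
    Kraft weights of a pair (A, B) multiply to exactly its weight, so that
    averaging Gibbs' inequality over independent random A and B leaves nothing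
    on the right-hand side (entropy_step, leaf_bound with parameter 0).

    To pass from weighted sums to cardinals, treat a coordinate i as free and
    let a0, a1 (b0, b1) be the contributions of the sets avoiding and containing
    i.  Deleting the sets that contain i gives a0 b0 <= K by induction, and
    giving i the weight x gives (a0 x + a1)(b0 (1 - x) + b1) <= K for each x.
    If A and B have a1/a0 + b1/b0 < 1 the first inequality, otherwise the second
    one at the balanced x, yields (a0 + a1)(b0 + b1) <= (9/4) K by the inequality
    between arithmetic and geometric means (one_coordinate, tree_step).

    Strict bound for recovering pairs.  All of the above can only be tight if
    coordinates are deleted with frequency 1/3 and the others carry weights
    near 1/2, with A and B behaving like random halves of the remaining ground
    set.  A recovering pair cannot do this.  The differences A \ B are distinct
    for distinct pairs (A, A intersected with B), so the sum over A of the number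
    of traces of the second family on A, a trace U being counted with weight
    3^(-|A \ U|), is at most (4/3)^n (sum_trace_weight); hence half of the sets A
    have a small weighted number M of traces.  For these A, and any further A',
    the set B is determined by its trace on A together with its part outside the
    union of A and A', a much smaller set than the complement of A'
    (trace_kraft).  Mixing this third Kraft-type inequality into the argument
    with a small weight lam gains the factor M^lam, where M is about (8/9)^n if
    there are about (3/2)^n sets A.  This is worth lam ln (9/8) per coordinate,
    and a weighted coordinate near the critical point loses less than that,
    because 2^11 < 3^7 (penalty_center); so each deleted coordinate contributes a
    net gain (recovering_bound).

    Lower bound for cancellative pairs.  Attach random vectors of F_2^(w+1) to
    the coordinates, and take the w-sets with linearly independent vectors and
    a prescribed vector sum.  If A and A' have the same union with B, then the
    symmetric difference of A and A' is a subset of B with vector sum 0, hence is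
    empty.  Such a family has at least binomial(n, w) / 2^(w+2) members for some
    choice of the vectors, and the sum of binomial(n, w) / 2^w is (3/2)^n.

    The rates of recovering pairs converge by Fekete's lemma, since recovering
    pairs on disjoint ground sets can be multiplied. *)

Set Implicit Arguments.
Unset Strict Implicit.

(** * Optimizing one coordinate *)

(** With c = 1 this turns a bound on the balanced product (s/2)^2 into one on
    ((1 + s)/2)^2 at the cost of adding 1/2 under the square; a smaller c records
    that e is bounded away from 1. *)
Lemma amgm_step (R : realFieldType) (e s w c : R) :
  0 <= e -> 0 <= s -> 0 <= w -> 0 <= c -> e <= c ^+ 2 -> c <= 1 ->
  e * (s ^+ 2 / 4) <= w ^+ 2 ->
  e * ((1 + s) ^+ 2 / 4) <= (c / 2 + w) ^+ 2.
Proof.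
move=> e0 s0 w0 c0 ec c1 H.
have H1 : e * s / 2 <= c * w.
  rewrite -(@ler_pXn2r _ 2)// ?nnegrE ?mulr_ge0//.
  have -> : (e * s / 2) ^+ 2 = e * (e * (s ^+ 2 / 4)) by field.
  rewrite exprMn; apply: ler_pM => //.
  by rewrite mulr_ge0// divr_ge0// sqr_ge0.
have -> : (1 + s) ^+ 2 = 1 + 2 * s + s ^+ 2 by ring.
have -> : (c / 2 + w) ^+ 2 = c ^+ 2 / 4 + c * w + w ^+ 2 by field.
by move: ec H1 H; clear; lra.
Qed.

(** Here e = a0 b0, a = a1/a0 and b = b1/b0.  The product (x + a)(1 - x + b) is
    largest at x = (1 + b - a)/2.  If a and b are almost equal, this x lies in
    the window around 1/2 where the good bound z^2 is available.  If they differ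
    more, (1 + a)(1 + b) falls short of its arithmetic-geometric bound by
    (a - b)^2/4, which absorbs the weaker bound Z^2.  If they differ so much that
    the balanced x leaves the unit interval, the last two hypotheses suffice,
    being the bounds for x near 0 and near 1. *)
Lemma one_coordinate_normalized (R : realFieldType) (z Z e a b : R) :
  1 <= z -> 1 <= Z -> Z <= 101 / 100 ->
  (1 / 2 + Z) ^+ 2 <= (1 / 2 + z) ^+ 2 + 1 / 500 / 1000 ->
  0 <= a -> 0 <= b -> 0 <= e -> e <= 1 ->
  (forall x, 1 / 100 <= x <= 99 / 100 ->
     e * ((x + a) * (1 - x + b)) <= Z ^+ 2) ->
  (forall x, `|x - 1 / 2| <= 1 / 500 ->
     e * ((x + a) * (1 - x + b)) <= z ^+ 2) ->
  e * (a * (1 + b)) <= 105 / 100 -> e * (b * (1 + a)) <= 105 / 100 ->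
  e * ((1 + a) * (1 + b)) <= (1 / 2 + z) ^+ 2.
Proof.
move=> z1 Z1 ZB zZ a0 b0 e0 e1 far near HL HR.
pose x := (1 + b - a) / 2; pose s := 1 + a + b.
have Ex : (x + a) * (1 - x + b) = s ^+ 2 / 4 by rewrite /x /s; field.
have Et : e * ((1 + a) * (1 + b)) =
    e * ((1 + s) ^+ 2 / 4) - e * ((a - b) ^+ 2 / 4).
  by rewrite /s; field.
have s0 : 0 <= s by rewrite !addr_ge0.
have z0 : 0 <= z by exact: le_trans z1.
have Z0 : 0 <= Z by exact: le_trans Z1.
have sq0 : 0 <= e * ((a - b) ^+ 2 / 4) by rewrite mulr_ge0// divr_ge0// sqr_ge0.
have rho : 9 / 4 <= (1 / 2 + z) ^+ 2.
  have -> : 9 / 4 = (1 / 2 + 1) ^+ 2 :> R by field.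
  by rewrite ler_pXn2r ?nnegrE ?addr_ge0// lerD2l.
have [nr|fr] := lerP `|a - b| (1 / 250).
  have nx : `|x - 1 / 2| <= 1 / 500.
    have -> : x - 1 / 2 = (b - a) / 2 by rewrite /x; field.
    rewrite normrM distrC normfV (@ger0_norm _ 2)//.
    by rewrite ler_pdivrMr//; apply: le_trans nr _; clear; lra.
  have := near x nx; rewrite Ex => /(@amgm_step _ _ _ _ 1 e0 s0 z0 ler01).
  rewrite expr1n => /(_ e1 (lexx _)); rewrite Et.
  by move: sq0; clear; lra.
have [mid|out] := lerP `|a - b| (98 / 100).
  have H : e * (s ^+ 2 / 4) <= Z ^+ 2.
    rewrite -Ex; apply: far; move: mid; rewrite ler_norml => /andP[].
    by rewrite /x; clear; move=> m1 m2; apply/andP; split; lra.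
  have sq : 1 / 250 / 250 <= (a - b) ^+ 2.
    rewrite -real_normK ?num_real//.
    have -> : 1 / 250 / 250 = (1 / 250) ^+ 2 :> R by field.
    rewrite (@ler_pXn2r _ 2 isT) ?nnegrE; [exact: ltW| |exact: normr_ge0].
    by clear; lra.
  have [eh|eh] := lerP (1 / 2) e.
    have := @amgm_step _ _ _ _ 1 e0 s0 Z0 ler01.
    rewrite expr1n => /(_ e1 (lexx _) H); rewrite Et.
    have : 0 <= (e - 1 / 2) * ((a - b) ^+ 2 / 4).
      by rewrite mulr_ge0 ?subr_ge0// divr_ge0 ?sqr_ge0//.
    by move: zZ sq; clear; lra.
  have c0 : 0 <= 71 / 100 :> R by clear; lra.
  have c1 : 71 / 100 <= 1 :> R by clear; lra.
  have ec : e <= (71 / 100) ^+ 2 by move: eh; clear; lra.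
  have := @amgm_step _ _ _ _ _ e0 s0 Z0 c0 ec c1 H.
  rewrite Et => H1.
  have : (71 / 100 / 2 + Z) ^+ 2 <= (3 / 2) ^+ 2.
    rewrite (@ler_pXn2r _ 2 isT) ?nnegrE; first by move: ZB; clear; lra.
      by move: Z0; clear; lra.
    by clear; lra.
  move=> H2; apply: le_trans rho; rewrite (_ : 9 / 4 = (3 / 2) ^+ 2); last by field.
  by apply: le_trans H2; move: H1 sq0; clear; lra.
(* here the bounds for x near 0 and near 1 suffice *)
apply: le_trans rho.
move: out; rewrite ltr_normr => /orP[out|out].
  have : e * (1 + b) * (98 / 100 * (1 + a)) <= e * (1 + b) * (2 * a).
    apply: ler_wpM2l; first by rewrite mulr_ge0// addr_ge0.
    by move: out b0; clear; lra.
  by move: HL; clear; lra.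
have : e * (1 + a) * (98 / 100 * (1 + b)) <= e * (1 + a) * (2 * b).
  apply: ler_wpM2l; first by rewrite mulr_ge0// addr_ge0.
  by move: out a0; clear; lra.
by move: HR; clear; lra.
Qed.

(** The equality case z = Z = 1 is a0 b0 = 1 and a1/a0 = b1/b0 = 1/2, where the
    second hypothesis is tight exactly at x = 1/2.  This is why only the values
    of x near 1/2 need the sharp constant z, and a larger Z is harmless
    elsewhere. *)
Lemma one_coordinate (R : realFieldType) (z Z a0 a1 b0 b1 : R) :
  1 <= z -> 1 <= Z -> Z <= 101 / 100 ->
  (1 / 2 + Z) ^+ 2 <= (1 / 2 + z) ^+ 2 + 1 / 500 / 1000 ->
  0 <= a0 -> 0 <= a1 -> 0 <= b0 -> 0 <= b1 -> a0 * b0 <= 1 ->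
  (forall x, 1 / 100 <= x <= 99 / 100 ->
     (a0 * x + a1) * (b0 * (1 - x) + b1) <= Z ^+ 2) ->
  (forall x, `|x - 1 / 2| <= 1 / 500 ->
     (a0 * x + a1) * (b0 * (1 - x) + b1) <= z ^+ 2) ->
  (a0 + a1) * (b0 + b1) <= (1 / 2 + z) ^+ 2.
Proof.
move=> z1 Z1 ZB zZ a0ge a1ge b0ge b1ge e1 far near.
have Z2 : Z ^+ 2 <= 103 / 100.
  have : Z ^+ 2 <= (101 / 100) ^+ 2 by rewrite ler_pXn2r ?nnegrE// (le_trans ler01).
  by clear; lra.
have HL : a1 * (b0 + b1) <= 105 / 100.
  have := far (1 / 100).
  rewrite (_ : 1 - 1 / 100 = 99 / 100); last by field.
  move=> /(_ ltac:(by clear; lra)) H.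
  have : a1 * (99 / 100 * (b0 + b1)) <=
      (a0 * (1 / 100) + a1) * (b0 * (99 / 100) + b1).
    apply: ler_pM; first exact: a1ge.
    - by move: b0ge b1ge; clear; lra.
    - by rewrite lerDr mulr_ge0.
    - by move: b0ge b1ge; clear; lra.
  by move: Z2 H; clear; lra.
have HR : b1 * (a0 + a1) <= 105 / 100.
  have := far (99 / 100).
  rewrite (_ : 1 - 99 / 100 = 1 / 100); last by field.
  move=> /(_ ltac:(by clear; lra)) H.
  have : 99 / 100 * (a0 + a1) * b1 <=
      (a0 * (99 / 100) + a1) * (b0 * (1 / 100) + b1).
    apply: ler_pM; last by rewrite lerDr mulr_ge0.
    - by move: a0ge a1ge; clear; lra.
    - exact: b1ge.
    - by move: a0ge a1ge; clear; lra.
  by move: Z2 H; clear; lra.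
have rho : 9 / 4 <= (1 / 2 + z) ^+ 2.
  have -> : 9 / 4 = (1 / 2 + 1) ^+ 2 :> R by field.
  have z0 : 0 <= z by exact: le_trans z1.
  by rewrite ler_pXn2r ?nnegrE ?addr_ge0// lerD2l.
have [a00|a0n0] := eqVneq a0 0.
  by apply: le_trans rho; rewrite a00 add0r; apply: le_trans HL _; clear; lra.
have [b00|b0n0] := eqVneq b0 0.
  apply: le_trans rho; rewrite b00 add0r mulrC.
  by apply: le_trans HR _; clear; lra.
pose a := a1 / a0; pose b := b1 / b0.
have Ea1 : a1 = a0 * a by rewrite /a mulrC divfK.
have Eb1 : b1 = b0 * b by rewrite /b mulrC divfK.
have -> : (a0 + a1) * (b0 + b1) = a0 * b0 * ((1 + a) * (1 + b)).
  by rewrite Ea1 Eb1; ring.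
apply: (@one_coordinate_normalized _ z Z) => //.
- by rewrite divr_ge0.
- by rewrite divr_ge0.
- by rewrite mulr_ge0.
- by move=> x /far; rewrite Ea1 Eb1; congr (_ <= _); ring.
- by move=> x /near; rewrite Ea1 Eb1; congr (_ <= _); ring.
- by move: HL; rewrite Ea1 Eb1; congr (_ <= _); ring.
- by move: HR; rewrite Ea1 Eb1; congr (_ <= _); ring.
Qed.

(** * Inequalities of Kraft and Gibbs *)

Lemma ln_prod (R : realType) (I : finType) (P : pred I) (f : I -> R) :
  (forall i, 0 < f i) -> ln (\prod_(i | P i) f i) = \sum_(i | P i) ln (f i).
Proof.
move=> f0.
rewrite -[RHS]expRK expR_sum; congr ln.
by apply: eq_bigr => i _; rewrite lnK// posrE.
Qed.

(** Total mass of the product measure of densities r on D and 0 off D. *)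
Lemma sum_bernoulli (R : comPzRingType) (T : finType) (D : {set T}) (r : T -> R) :
  \sum_(U : {set T}) \prod_i (if i \in U then (if i \in D then r i else 0)
                               else (if i \in D then 1 - r i else 1)) = 1.
Proof.
rewrite -bigA_distr big1// => i _.
by case: (i \in D); rewrite /= ?add0r// addrCA subrr addr0.
Qed.

(** The traces on D of the members of F are disjoint events for the product
    measure with densities r on D. *)
Lemma kraft (R : realFieldType) (T : finType) (F : {set {set T}}) (D : {set T})
    (r : T -> R) :
  (forall i, 0 <= r i <= 1) ->
  {in F &, injective (fun A => A :&: D)} ->
  \sum_(A in F) \prod_(i in D) (if i \in A then r i else 1 - r i) <= 1.
Proof.
move=> r01 inj.
pose g (U : {set T}) := \prod_i (if i \in U then (if i \in D then r i else 0)
                                 else (if i \in D then 1 - r i else 1)).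
have g1 : \sum_(U : {set T}) g U = 1 := sum_bernoulli D r.
rewrite -[leRHS]g1.
have E (A : {set T}) : \prod_(i in D) (if i \in A then r i else 1 - r i) = g (A :&: D).
  rewrite /g big_mkcond; apply: eq_bigr => i _; rewrite inE.
  by case: (i \in D); case: (i \in A).
rewrite (eq_bigr (fun A => g (A :&: D))) => [|A _]; last exact: E.
rewrite -(big_imset g inj) /=.
rewrite [leRHS](bigID (mem [set A :&: D | A in F])) /= lerDl sumr_ge0// => U _.
apply: prodr_ge0 => i _; have /andP[r0 r1] := r01 i.
by case: ifP => _; case: ifP => _ //; rewrite ?ler01// subr_ge0.
Qed.

(** For the probability law mu proportional to a, this is
    H(mu) <= ln M - E ln k, Jensen's inequality for the logarithm, written with
    H(mu) = ln Z - E ln a where Z is the sum of a. *)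
Lemma gibbs (R : realType) (I : finType) (D : {set I}) (a k : I -> R) (M : R) :
  (forall i, 0 < a i) -> (forall i, 0 < k i) -> 0 < M -> D != finset.set0 ->
  \sum_(i in D) k i <= M ->
  ln (\sum_(i in D) a i) +
    \sum_(i in D) a i / (\sum_(j in D) a j) * (ln (k i) - ln (a i)) <= ln M.
Proof.
move=> a0 k0 M0 /set0Pn[i0 i0D] kM; set Z := \sum_(i in D) a i.
have Z0 : 0 < Z.
  by rewrite /Z (bigD1 i0)//= ltr_wpDr// sumr_ge0// => i _; exact: ltW.
have m1 : \sum_(i in D) a i / Z = 1 by rewrite -mulr_suml divff// gt_eqF.
rewrite -lerBrDl -[leRHS]mul1r -m1 mulr_suml -subr_ge0 -sumrB.
have : \sum_(i in D) (a i / Z - k i / M) <=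
    \sum_(i in D) (a i / Z * (ln M - ln Z) - a i / Z * (ln (k i) - ln (a i))).
  apply: ler_sum => i _.
  have -> : a i / Z * (ln M - ln Z) - a i / Z * (ln (k i) - ln (a i)) =
      - (a i / Z * ln ((k i * Z) / (a i * M))).
    rewrite ln_div ?posrE ?mulr_gt0// !lnM ?posrE//; ring.
  have /(@le_ln1Dx R) : -1 < (k i * Z) / (a i * M) - 1.
    by rewrite ltrBrDr addNr divr_gt0// mulr_gt0.
  rewrite addrC subrK => /(ler_wpM2l (ltW (divr_gt0 (a0 i) Z0))) H.
  rewrite lerNr; apply: le_trans H _.
  rewrite le_eqVlt; apply/orP; left; apply/eqP.
  by field; rewrite !gt_eqF.
apply: le_trans; rewrite sumrB m1 -mulr_suml subr_ge0.
by rewrite ler_pdivrMr// mul1r.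
Qed.

Section Marginals.
Context {R : realType} {T : finType}.
Variables (F : {set {set T}}) (m : {set T} -> R).

Definition marginal (i : T) : R := \sum_(A in F) m A * (i \in A)%:R.

Hypotheses (m0 : forall A, 0 <= m A) (m1 : \sum_(A in F) m A = 1).

Lemma marginal_itv i : 0 <= marginal i <= 1.
Proof.
apply/andP; split; first by apply: sumr_ge0 => A _; rewrite mulr_ge0.
by rewrite -m1; apply: ler_sum => A _; rewrite ler_piMr// lern1 leq_b1.
Qed.

Lemma avg_cst (c : R) : \sum_(A in F) m A * c = c.
Proof. by rewrite -mulr_suml m1 mul1r. Qed.

Lemma avg_local (D : {set T}) (u v : T -> R) :
  \sum_(A in F) m A * \sum_(i in D) (if i \in A then u i else v i) =
  \sum_(i in D) (marginal i * u i + (1 - marginal i) * v i).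
Proof.
under eq_bigr do rewrite mulr_sumr.
rewrite exchange_big; apply: eq_bigr => i _ /=.
rewrite -[X in (X - _) * _]m1 /marginal -sumrB !mulr_suml -big_split /=.
by apply: eq_bigr => A _; case: (i \in A); rewrite ?mulr1 ?mulr0; ring.
Qed.

Lemma avg_out (D : {set T}) (g : T -> R) :
  \sum_(A in F) m A * \sum_(i in D :\: A) g i =
  \sum_(i in D) (1 - marginal i) * g i.
Proof.
transitivity (\sum_(i in D) (marginal i * 0 + (1 - marginal i) * g i)); last first.
  by apply: eq_bigr => i _; rewrite mulr0 add0r.
rewrite -avg_local; apply: eq_bigr => A _; congr (_ * _).
rewrite big_mkcond [RHS]big_mkcond; apply: eq_bigr => i _; rewrite inE.
by case: (i \in A); case: (i \in D).
Qed.

Lemma avg_in (D : {set T}) (g : T -> R) :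
  \sum_(A in F) m A * \sum_(i in D :&: A) g i = \sum_(i in D) marginal i * g i.
Proof.
transitivity (\sum_(i in D) (marginal i * g i + (1 - marginal i) * 0)); last first.
  by apply: eq_bigr => i _; rewrite mulr0 addr0.
rewrite -avg_local; apply: eq_bigr => A _; congr (_ * _).
rewrite big_mkcond [RHS]big_mkcond; apply: eq_bigr => i _; rewrite inE.
by case: (i \in A); case: (i \in D).
Qed.

End Marginals.

(** * Entropy inequalities for weighted families *)

Section Weights.
Context {R : realType} {T : finType}.
Implicit Types (S A B : {set T}) (x : T -> R) (F G : {set {set T}}).

Definition weight S x A : R := \prod_(i in S :\: A) x i.

Definition wsum S x F : R := \sum_(A in F) weight S x A.

Definition gibbs_law S x F A : R := weight S x A / wsum S x F.

Lemma weight_gt0 S x A : (forall i, 0 < x i) -> 0 < weight S x A.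
Proof. by move=> x0; apply: prodr_gt0 => i _. Qed.

Lemma wsum_gt0 S x F : (forall i, 0 < x i) -> F != finset.set0 -> 0 < wsum S x F.
Proof.
move=> x0 /set0Pn[A AF]; rewrite /wsum (bigD1 A)//=.
rewrite ltr_wpDr ?weight_gt0// sumr_ge0// => B _; exact/ltW/weight_gt0.
Qed.

Lemma gibbs_law_ge0 S x F A : (forall i, 0 < x i) -> 0 <= gibbs_law S x F A.
Proof.
move=> x0; apply: divr_ge0; first exact/ltW/weight_gt0.
by apply: sumr_ge0 => B _; exact/ltW/weight_gt0.
Qed.

Lemma gibbs_law_sum S x F : (forall i, 0 < x i) -> F != finset.set0 ->
  \sum_(A in F) gibbs_law S x F A = 1.
Proof. by move=> x0 F0; rewrite -mulr_suml divff// gt_eqF// wsum_gt0. Qed.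

Lemma avg_ln_weight S x F : (forall i, 0 < x i) -> F != finset.set0 ->
  \sum_(A in F) gibbs_law S x F A * ln (weight S x A) =
  \sum_(i in S) (1 - marginal F (gibbs_law S x F) i) * ln (x i).
Proof.
move=> x0 F0; rewrite -avg_out ?gibbs_law_sum//.
by apply: eq_bigr => A _; rewrite /weight ln_prod.
Qed.

(** Since A is determined by its part in S \ B, Kraft's inequality with
    densities r holds for each B; the statement is the average over the law m of
    B of the resulting Gibbs inequalities. *)
Lemma entropy_step S x F G (r : T -> R) (m : {set T} -> R)
    (p := marginal F (gibbs_law S x F)) (q := marginal G m) :
  (forall i, 0 < x i) -> (forall i, 0 < r i < 1) -> F != finset.set0 ->
  (forall A, 0 <= m A) -> \sum_(B in G) m B = 1 ->
  {in G, forall B, {in F &, injective (fun A => A :&: (S :\: B))}} ->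
  ln (wsum S x F) +
    \sum_(i in S) ((1 - q i) * (p i * ln (r i) + (1 - p i) * ln (1 - r i))
                   - (1 - p i) * ln (x i)) <= 0.
Proof.
move=> x0 r01 F0 m0 m1 inj; rewrite sumrB -(avg_ln_weight S x0 F0) -avg_out//.
rewrite -[ln _](avg_cst m1) -[X in _ - X](avg_cst m1) -sumrB -big_split /=.
apply: sumr_le0 => B BG; rewrite -mulrBr -mulrDr mulr_ge0_le0//.
have r01' i : 0 <= r i <= 1 by have /andP[r0 r1] := r01 i; rewrite !ltW.
pose k A := \prod_(i in S :\: B) (if i \in A then r i else 1 - r i).
have k0 A : 0 < k A.
  apply: prodr_gt0 => i _; have /andP[r0 r1] := r01 i.
  by case: ifP => _ //; rewrite subr_gt0.
have := gibbs (fun A => weight_gt0 S A x0) k0 ltr01 F0 (kraft r01' (inj B BG)).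
rewrite ln1; apply: le_trans.
rewrite lerD2l -/(wsum S x F) -/(gibbs_law S x F _).
under [leRHS]eq_bigr do rewrite mulrBr.
rewrite sumrB lerD2r -avg_local ?gibbs_law_sum//.
rewrite le_eqVlt; apply/orP; left; apply/eqP.
apply: eq_bigr => A _; rewrite /k ln_prod => [|i].
  by congr (_ * _); apply: eq_bigr => i _; case: ifP.
by have /andP[r0 r1] := r01 i; case: ifP => _ //; rewrite subr_gt0.
Qed.

(** Number of traces A intersected with B, where those leaving much of A
    uncovered count less.  The base 3 makes the product measure of density 1/4
    appear, 1/4 being the density of A \ B for independent random halves. *)
Definition trace_weight G A : R :=
  \sum_(U in [set A :&: B | B in G]) 3^-1 ^+ #|A :\: U|.

Lemma trace_weight_ge0 G A : 0 <= trace_weight G A.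
Proof. by apply: sumr_ge0 => U _; rewrite exprn_ge0. Qed.

Lemma trace_weight_sub G G' A : G' \subset G -> trace_weight G' A <= trace_weight G A.
Proof.
move=> sG; have sI := imsetS (fun B => A :&: B) sG.
rewrite [leRHS](bigID (mem [set A :&: B | B in G'])) /=.
rewrite (eq_bigl (mem [set A :&: B | B in G'])) ?lerDl.
  by apply: sumr_ge0 => U _; rewrite exprn_ge0.
move=> U /=; apply/andb_idl; exact: (fintype.subsetP sI).
Qed.

(** Among the B with a given trace on A, the part of B outside the union of A
    and A' determines the part outside A', hence B.  So Kraft's inequality holds
    for each trace separately, on a ground set smaller than S \ A. *)
Lemma trace_kraft S F G A A' x (M : R) :
  (forall i, 0 < x i < 1) -> A \in F -> A' \in F ->
  {in F, forall A, {in G &, injective (fun B => B :&: (S :\: A))}} ->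
  trace_weight G A <= M ->
  \sum_(B in G) (3^-1 ^+ #|A :\: B| *
     \prod_(i in S :\: (A :|: A')) (if i \in B then x i else 1 - x i)) <= M.
Proof.
move=> x01 AF A'F inj; apply: le_trans.
rewrite (partition_big_imset (fun B => A :&: B)) /=.
apply: ler_sum => U UG.
under eq_bigr => B /andP[BG /eqP EU].
  have -> : A :\: B = A :\: U by rewrite -EU finset.setDIr finset.setDv finset.set0U.
  over.
rewrite -mulr_sumr ler_piMr ?exprn_ge0//.
rewrite (eq_bigl (mem [set B in G | A :&: B == U])) => [|B]; last by rewrite !inE.
apply: kraft => [i|B B'].
  by have /andP[r0 r1] := x01 i; rewrite !ltW.
rewrite !inE => /andP[BG /eqP EB] /andP[B'G /eqP EB'] /finset.setP E.
apply: (inj A' A'F) => //; apply/finset.setP => i; have := E i.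
have : (i \in A :&: B) = (i \in A :&: B') by rewrite EB EB'.
rewrite !inE.
by case: (i \in A); case: (i \in A'); case: (i \in S); case: (i \in B);
  case: (i \in B').
Qed.

(** Gibbs' inequality for trace_kraft, averaged over two independent copies A
    and A' of the random member of F; a coordinate avoids both with probability
    (1 - p)^2. *)
Lemma trace_step S x y F G (M : R) (p := marginal F (gibbs_law S x F))
    (q := marginal G (gibbs_law S y G)) :
  (forall i, 0 < x i < 1) -> (forall i, 0 < y i < 1) ->
  F != finset.set0 -> G != finset.set0 -> 0 < M ->
  {in F, forall A, A \subset S} ->
  {in F, forall A, {in G &, injective (fun B => B :&: (S :\: A))}} ->
  {in F, forall A, trace_weight G A <= M} ->
  ln (wsum S y G) +
    \sum_(i in S) (p i * ((1 - q i) * - ln 3) +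
       (1 - p i) * ((1 - p i) * (q i * ln (x i) + (1 - q i) * ln (1 - x i))) -
       (1 - q i) * ln (y i)) <= ln M.
Proof.
move=> x01 y01 F0 G0 M0 FS inj trM.
have x0 i : 0 < x i by have /andP[] := x01 i.
have y0 i : 0 < y i by have /andP[] := y01 i.
have nx0 i : 0 < 1 - x i by have /andP[_] := x01 i; rewrite subr_gt0.
have m1 := gibbs_law_sum S x0 F0; have m0 A := gibbs_law_ge0 S F A x0.
rewrite sumrB big_split /= -avg_in// -avg_out//.
rewrite -big_split /= -[ln (wsum _ _ _)](avg_cst m1) -[X in _ - X](avg_cst m1).
rewrite -sumrB -big_split /= -[leRHS](avg_cst m1).
apply: ler_sum => A AF; rewrite -!mulrDr -mulrBr -mulrDr ler_wpM2l//.
rewrite -(avg_out m1 (S :\: A)) -[X in _ + (X + _ - _)](avg_cst m1) -big_split /=.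
rewrite -[ln (wsum _ _ _)](avg_cst m1) -[X in _ - X](avg_cst m1).
rewrite -sumrB -big_split /= -[leRHS](avg_cst m1).
apply: ler_sum => A' A'F; rewrite -!mulrDr -mulrBr -mulrDr ler_wpM2l//.
pose k B : R := 3^-1 ^+ #|A :\: B| *
     \prod_(i in S :\: (A :|: A')) (if i \in B then x i else 1 - x i).
have k0 B : 0 < k B.
  by rewrite mulr_gt0 ?exprn_gt0// prodr_gt0// => i _; case: ifP.
have := gibbs (fun A => weight_gt0 S A y0) k0 M0 G0 (trace_kraft x01 AF A'F inj (trM A AF)).
apply: le_trans; rewrite -/(wsum S y G) lerD2l.
under eq_bigr do rewrite -/(gibbs_law S y G _).
under [leRHS]eq_bigr do rewrite -/(gibbs_law S y G _) mulrBr.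
rewrite sumrB -(avg_ln_weight S y0 G0) lerD2r.
rewrite le_eqVlt; apply/orP; left; apply/eqP.
have -> : S :&: A = A by apply/finset.setIidPr/FS.
rewrite -avg_out ?gibbs_law_sum// finset.setDDl -avg_local ?gibbs_law_sum//.
rewrite -big_split /=; apply: eq_bigr => B _; rewrite -mulrDr; congr (_ * _).
rewrite /k lnM ?posrE ?exprn_gt0 ?prodr_gt0//; last by move=> i _; case: ifP.
rewrite ln_prod => [|i]; last by case: ifP.
congr (_ + _); last by apply: eq_bigr => i _; case: ifP.
by rewrite lnXn// lnV ?posrE// sumr_const.
Qed.

End Weights.

(** * Weighted sums of cancellative pairs *)

Section Leaf.
Context {R : realType}.

Lemma ln_ge_1subV (t : R) : 0 < t -> 1 - t^-1 <= ln t.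
Proof.
move=> t0; have : ln (1 + (t^-1 - 1)) <= t^-1 - 1.
  by apply: le_ln1Dx; rewrite ltrBrDr addNr invr_gt0.
by rewrite addrCA subrr addr0 lnV ?posrE// lerNl opprB.
Qed.

Lemma ln1D_ge (u : R) : - (1 / 2) <= u -> u - 2 * u ^+ 2 <= ln (1 + u).
Proof.
move=> u2; have u1 : 0 < 1 + u by lra.
apply: le_trans (ln_ge_1subV u1).
have E : (1 - (1 + u)^-1) * (1 + u) = u.
  by rewrite mulrBl mulVf ?gt_eqF// mul1r addrAC subrr add0r.
rewrite -(ler_pM2r u1) E.
have : 0 <= u ^+ 2 * (u + 1 / 2) by rewrite mulr_ge0 ?sqr_ge0//; lra.
by clear; lra.
Qed.

(** The density 1 - x moved towards p: it equals
    1 - x + x (1 - x) (p - (1 - x)) / 4.  With density 1 - x the entropy bounds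
    hold with no slack at all; tilting towards the true marginal p gains a
    quadratic amount, by tilt_gain. *)
Definition tilt (x p : R) : R := (1 - x) * (1 + (p - (1 - x)) / 4 * x).

Lemma tilt_compl x p : 1 - tilt x p = x * (1 - (p - (1 - x)) / 4 * (1 - x)).
Proof. by rewrite /tilt; field. Qed.

Lemma tilt_bound (x y p : R) : 0 <= p <= 1 -> 0 < x < 1 -> 0 < y < 1 ->
  - (1 / 4) <= (p - x) / 4 * y <= 1 / 4.
Proof.
move=> /andP[p0 p1] /andP[x0 x1] /andP[y0 y1].
rewrite -ler_norml normrM -[leRHS]mulr1; apply: ler_pM => //.
  by rewrite ler_norml; apply/andP; split; lra.
by rewrite ger0_norm ltW.
Qed.

Lemma tilt_itv x p : 0 < x < 1 -> 0 <= p <= 1 -> 0 < tilt x p < 1.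
Proof.
move=> x01 p01; have /andP[x0 x1] := x01.
have y01 : 0 < 1 - x < 1 by apply/andP; split; lra.
have /andP[b1 b2] := tilt_bound p01 y01 x01.
have /andP[b3 b4] := tilt_bound p01 y01 y01.
rewrite -[X in _ && X]subr_gt0 tilt_compl /tilt !mulr_gt0//; lra.
Qed.

Lemma tilt_gain x p : 0 < x < 1 -> 0 <= p <= 1 ->
  p * ln (1 - x) + (1 - p) * ln x + (p - (1 - x)) ^+ 2 / 8 <=
  p * ln (tilt x p) + (1 - p) * ln (1 - tilt x p).
Proof.
move=> x01 p01; have /andP[x0 x1] := x01; have /andP[p0 p1] := p01.
have y01 : 0 < 1 - x < 1 by apply/andP; split; lra.
have /andP[b1 b2] := tilt_bound p01 y01 x01.
have /andP[b3 b4] := tilt_bound p01 y01 y01.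
rewrite tilt_compl /tilt !lnM ?posrE; try lra.
move: b1 b2 b3 b4; set u := _ / 4 * x; set v := _ / 4 * (1 - x) => b1 b2 b3 b4.
have H1 : p * (u - 2 * u ^+ 2) <= p * ln (1 + u).
  by apply: ler_wpM2l => //; apply: ln1D_ge; lra.
have H2 : (1 - p) * (- v - 2 * v ^+ 2) <= (1 - p) * ln (1 - v).
  by rewrite -sqrrN; apply: ler_wpM2l; [lra|apply: ln1D_ge; lra].
set d := p - (1 - x) in u v b1 b2 b3 b4 H1 H2 *.
have Hu : p * u - (1 - p) * v = d ^+ 2 / 4 by rewrite /u /v /d; field.
have Hv : p * u ^+ 2 + (1 - p) * v ^+ 2 <= d ^+ 2 / 16.
  have -> : p * u ^+ 2 + (1 - p) * v ^+ 2 =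
    d ^+ 2 / 16 * (p * x ^+ 2 + (1 - p) * (1 - x) ^+ 2) by rewrite /u /v; field.
  rewrite ler_piMr ?divr_ge0 ?sqr_ge0//.
  have : x ^+ 2 <= 1 by rewrite expr_le1 ?ltW.
  have : (1 - x) ^+ 2 <= 1 by rewrite expr_le1 ?ltW//; lra.
  move=> /(ler_wpM2l (_ : 0 <= 1 - p)) => /(_ ltac:(lra)) h1.
  by move=> /(ler_wpM2l p0); move: h1; clear; lra.
move: H1 H2 Hu Hv; clear; lra.
Qed.

(** Loss per coordinate, in terms of the marginals p and q, when the basic
    entropy inequality for B is replaced by trace_step. *)
Definition penalty (p q x : R) : R :=
  p * (1 - q) * ln 3 + p * (1 - p) * (q * ln x + (1 - q) * ln (1 - x)).

(** Add entropy_step for F, (1 - lam) times entropy_step for G and lam times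
    trace_step.  With the densities 1 - x and x every logarithm would cancel
    except for lam times the penalty; the tilted densities contribute the two
    squares, which pay for the penalty away from p = 1 - x, q = x.  The bound for
    cancellative pairs is the case lam = 0, c = 0. *)
Lemma leaf_bound (T : finType) (S : {set T}) (x c : T -> R)
    (F G : {set {set T}}) (lam M : R) :
  (forall i, 0 < x i < 1) -> 0 <= lam <= 1 -> 0 < M ->
  {in F, forall A : {set T}, A \subset S} ->
  {in F, forall A, {in G &, injective (fun B => B :&: (S :\: A))}} ->
  {in G, forall B, {in F &, injective (fun A => A :&: (S :\: B))}} ->
  {in F, forall A, trace_weight G A <= M} ->
  (forall i (p q : R), 0 <= p <= 1 -> 0 <= q <= 1 ->
     lam * penalty p q (x i) <=
     c i + (1 - q) * ((p - (1 - x i)) ^+ 2 / 8) +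
     (1 - lam) * ((1 - p) * ((q - x i) ^+ 2 / 8))) ->
  wsum S x F * wsum S (fun i => 1 - x i) G <=
  expR (lam * ln M + \sum_(i in S) c i).
Proof.
move=> x01 /andP[lam0 lam1] M0 FS injG injF trM loc.
have [->|F0] := eqVneq F finset.set0.
  by rewrite {1}/wsum big_set0 mul0r expR_ge0.
have [->|G0] := eqVneq G finset.set0.
  by rewrite {2}/wsum big_set0 mulr0 expR_ge0.
pose y i := 1 - x i.
have y01 i : 0 < y i < 1 by have /andP[] := x01 i; rewrite /y; lra.
have x0 i : 0 < x i by have /andP[] := x01 i.
have y0 i : 0 < y i by have /andP[] := y01 i.
have ZF := wsum_gt0 S x0 F0; have ZG := wsum_gt0 S y0 G0.
rewrite -/y -ler_ln ?posrE ?mulr_gt0 ?expR_gt0// expRK lnM ?posrE//.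
have mF0 A := gibbs_law_ge0 S F A x0; have mF1 := gibbs_law_sum S x0 F0.
have mG0 A := gibbs_law_ge0 S G A y0; have mG1 := gibbs_law_sum S y0 G0.
pose p := marginal F (gibbs_law S x F); pose q := marginal G (gibbs_law S y G).
have p01 i : 0 <= p i <= 1 := marginal_itv mF0 mF1 i.
have q01 i : 0 <= q i <= 1 := marginal_itv mG0 mG1 i.
have r01 i : 0 < tilt (x i) (p i) < 1 := tilt_itv (x01 i) (p01 i).
have s01 i : 0 < tilt (y i) (q i) < 1 := tilt_itv (y01 i) (q01 i).
have := entropy_step x0 r01 F0 mG0 mG1 injF.
have := entropy_step y0 s01 G0 mF0 mF1 injG.
have := trace_step x01 y01 F0 G0 M0 FS injG trM.
rewrite -/p -/q.
set SF := \sum_(i in S) _; set SG := \sum_(i in S) _; set ST := \sum_(i in S) _.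
move=> HT HG HF.
have : - (ST + (1 - lam) * SG + lam * SF) <= \sum_(i in S) c i.
  rewrite /ST /SG /SF !mulr_sumr -!big_split /= -sumrN; apply: ler_sum => i _.
  have := loc i (p i) (q i) (p01 i) (q01 i).
  have := tilt_gain (x01 i) (p01 i); have := tilt_gain (y01 i) (q01 i).
  have /andP[pi0 pi1] := p01 i; have /andP[qi0 qi1] := q01 i.
  rewrite (_ : 1 - y i = x i) /y ?subKr// /penalty.
  move: (_ * ln (tilt _ _) + _) (_ * ln (tilt _ _) + _) => u v.
  move: (ln (x i)) (ln (1 - x i)) => lx ly.
  move=> /(ler_wpM2l (_ : 0 <= (1 - lam) * (1 - p i))).
  move=> /(_ ltac:(by rewrite mulr_ge0// subr_ge0)).
  move=> hu /(ler_wpM2l (_ : 0 <= 1 - q i)) => /(_ ltac:(by rewrite subr_ge0)).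
  move: hu; clear; lra.
have := ler_wpM2l lam0 HT.
have : (1 - lam) * (ln (wsum S y G) + SG) <= 0.
  by rewrite mulr_ge0_le0// subr_ge0.
move: HF; clear; lra.
Qed.

End Leaf.

(** * Eliminating the free coordinates *)

Lemma central_itv (R : realFieldType) (t : R) :
  `|t - 1 / 2| <= 1 / 500 -> 1 / 100 <= t <= 99 / 100.
Proof. by rewrite ler_norml => /andP[t0 t1]; apply/andP; split; lra. Qed.

Section Tree.
Context {R : realType} {T : finType}.
Implicit Types (S A B D : {set T}) (x : T -> R) (F G : {set {set T}}).

Definition set_at x (i : T) (t : R) : T -> R := fun j => if j == i then t else x j.

Lemma weight_set_at S x i t A : i \notin S ->
  weight (i |: S) (set_at x i t) A =
  (if i \in A then 1 else t) * weight S x A.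
Proof.
move=> iS; have E : weight S (set_at x i t) A = weight S x A.
  apply: eq_bigr => j; rewrite inE => /andP[_ jS]; rewrite /set_at.
  by case: eqP jS iS => // -> ->.
rewrite -{}E /weight finset.setDUl; case: ifPn => iA.
  have -> : [set i] :\: A = finset.set0.
    by apply/eqP; rewrite finset.setD_eq0 finset.sub1set.
  by rewrite finset.set0U mul1r.
have -> : [set i] :\: A = [set i].
  by apply/finset.setDidPl; rewrite disjoints1.
by rewrite big_setU1 /= ?inE ?(negbTE iS) ?andbF// /set_at eqxx.
Qed.

Lemma wsum_split S x F i :
  wsum S x F = wsum S x [set A in F | i \notin A] + wsum S x [set A in F | i \in A].
Proof.
rewrite /wsum (bigID (fun A => i \notin A)) /=; congr (_ + _).
  by apply: eq_bigl => A; rewrite !inE.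
by apply: eq_bigl => A; rewrite !inE negbK.
Qed.

Lemma wsum_set_at S x F i t : i \notin S ->
  wsum (i |: S) (set_at x i t) F =
  wsum S x [set A in F | i \notin A] * t + wsum S x [set A in F | i \in A].
Proof.
move=> iS; rewrite (wsum_split _ _ _ i) /wsum mulr_suml; congr (_ + _).
  apply: eq_bigr => A; rewrite inE => /andP[_ iA].
  by rewrite weight_set_at// (negbTE iA) mulrC.
apply: eq_bigr => A; rewrite inE => /andP[_ iA].
by rewrite weight_set_at// iA mul1r.
Qed.

Lemma wsum_ge0 S x F : (forall i, 0 <= x i) -> 0 <= wsum S x F.
Proof. by move=> x0; apply: sumr_ge0 => A _; apply: prodr_ge0. Qed.

(** Loss allowed for a coordinate of weight t: the value t = 1/2 is the critical
    one, so the sharp constant is required only near it. *)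
Definition cost (z Z t : R) : R := if `|t - 1 / 2| <= 1 / 500 then z ^+ 2 else Z ^+ 2.

Variables (z Z L : R) (F0 G0 : {set {set T}}).
Hypotheses (z1 : 1 <= z) (zZ : z <= Z) (ZB : Z <= 101 / 100)
  (zZ2 : (1 / 2 + Z) ^+ 2 <= (1 / 2 + z) ^+ 2 + 1 / 500 / 1000) (L0 : 0 < L).
Hypothesis leaf : forall S x F G, F \subset F0 -> G \subset G0 ->
  {in F, forall A : {set T}, A \subset S} ->
  {in G, forall B : {set T}, B \subset S} ->
  (forall i, 1 / 100 <= x i <= 99 / 100) ->
  wsum S x F * wsum S (fun i => 1 - x i) G <= L * \prod_(i in S) cost z Z (x i).

(** Coordinates in S are weighted, those in D are free, and the others belong to
    no member of F or G.  A free coordinate i is removed either by keeping only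
    the members that avoid it, or by moving it to S with an arbitrary weight t;
    one_coordinate combines these options. *)
Lemma tree_step N D S x F G : #|D| = N -> [disjoint S & D] ->
  F \subset F0 -> G \subset G0 ->
  {in F, forall A : {set T}, A \subset S :|: D} ->
  {in G, forall B : {set T}, B \subset S :|: D} ->
  (forall i, 1 / 100 <= x i <= 99 / 100) ->
  wsum S x F * wsum S (fun i => 1 - x i) G <=
  L * \prod_(i in S) cost z Z (x i) * ((1 / 2 + z) ^+ 2) ^+ N.
Proof.
have z0 : 0 < z by exact: lt_le_trans z1.
have Z0 : 0 < Z by exact: lt_le_trans zZ.
have cost0 t : 0 < cost z Z t by rewrite /cost; case: ifP => _; rewrite exprn_gt0.
elim: N D S x F G => [|N IH] D S x F G cD dSD sF sG FS GS xB.
  move/eqP: cD; rewrite cards_eq0 => /eqP D0.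
  by rewrite expr0 mulr1; apply: leaf => //; rewrite -[S]finset.setU0 -D0.
have /card_gt0P[i iD] : (0 < #|D|)%N by rewrite cD.
have cD' : #|D :\ i| = N by move: cD; rewrite (cardsD1 i) iD add1n => -[].
have iS : i \notin S by rewrite (disjointFl dSD iD).
have x0 j : 0 <= x j by have /andP[] := xB j; lra.
have y0 j : 0 <= 1 - x j by have /andP[] := xB j; lra.
set y := fun j => 1 - x j.
pose Fo := [set A in F | i \notin A]; pose Fi := [set A in F | i \in A].
pose Go := [set A in G | i \notin A]; pose Gi := [set A in G | i \in A].
have sub (H : {set {set T}}) (P : pred {set T}) : [set A in H | P A] \subset H.
  by apply/fintype.subsetP => A; rewrite inE => /andP[].
pose K := L * \prod_(j in S) cost z Z (x j) * ((1 / 2 + z) ^+ 2) ^+ N.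
have K0 : 0 < K.
  by rewrite !mulr_gt0 ?exprn_gt0 ?addr_gt0// prodr_gt0.
have dead : wsum S x Fo * wsum S y Go <= K.
  apply: (IH (D :\ i)) => //.
  - by apply: disjointWr dSD; exact: subD1set.
  - exact: fintype.subset_trans (sub _ _) sF.
  - exact: fintype.subset_trans (sub _ _) sG.
  - move=> A; rewrite inE => /andP[AF iA]; apply/fintype.subsetP => j jA.
    have := fintype.subsetP (FS A AF) j jA; rewrite !inE.
    by case: eqP jA iA => // -> ->.
  - move=> A; rewrite inE => /andP[AF iA]; apply/fintype.subsetP => j jA.
    have := fintype.subsetP (GS A AF) j jA; rewrite !inE.
    by case: eqP jA iA => // -> ->.
have live t : 1 / 100 <= t <= 99 / 100 ->
    (wsum S x Fo * t + wsum S x Fi) * (wsum S y Go * (1 - t) + wsum S y Gi) <=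
    K * cost z Z t.
  move=> tB; rewrite -!wsum_set_at//.
  have -> : wsum (i |: S) (set_at y i (1 - t)) G =
            wsum (i |: S) (fun j => 1 - set_at x i t j) G.
    congr (wsum _ _ _); apply/funext => j; rewrite /set_at /y.
    by case: eqP.
  have -> : K * cost z Z t =
    L * \prod_(j in i |: S) cost z Z (set_at x i t j) * ((1 / 2 + z) ^+ 2) ^+ N.
    have xi : set_at x i t i = t by rewrite /set_at eqxx.
    rewrite big_setU1//= xi /K.
    rewrite [in RHS](eq_bigr (fun j => cost z Z (x j))) => [|j jS]; first by ring.
    by rewrite /set_at; case: eqP jS iS => // -> ->.
  have eSD : (i |: S) :|: (D :\ i) = S :|: D.
    rewrite finset.setUAC finset.setD1K //.
      by rewrite finset.setUC.
  apply: (IH (D :\ i)) => //; rewrite ?eSD//.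
  - rewrite disjoint_subset; apply/fintype.subsetP => j.
    rewrite !inE negb_and negbK => /orP[->//|jS].
    by rewrite (disjointFr dSD jS) orbT.
  - by move=> j; rewrite /set_at; case: eqP.
have -> : L * \prod_(j in S) cost z Z (x j) * ((1 / 2 + z) ^+ 2) ^+ N.+1 =
    K * (1 / 2 + z) ^+ 2 by rewrite /K exprSr mulrA.
rewrite (wsum_split _ _ F i) (wsum_split _ _ G i) -/Fo -/Fi -/Go -/Gi -/y.
have [fo fi] := (wsum_ge0 S Fo x0, wsum_ge0 S Fi x0).
have [go gi] := (wsum_ge0 S Go y0, wsum_ge0 S Gi y0).
move: dead live fo fi go gi.
move: (wsum S x Fo) (wsum S x Fi) (wsum S y Go) (wsum S y Gi).
move=> a0 a1 b0 b1 dead live a0ge a1ge b0ge b1ge.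
rewrite -ler_pdivrMl// mulrA [K^-1 * _]mulrDr.
apply: (@one_coordinate _ z Z) => //.
- exact: le_trans z1 zZ.
- by rewrite mulr_ge0// invr_ge0 ltW.
- by rewrite mulr_ge0// invr_ge0 ltW.
- by rewrite -mulrA ler_pdivrMl// mulr1.
- move=> t tB; rewrite -mulrA -mulrDr -mulrA ler_pdivrMl//.
  apply: le_trans (live t tB) _; rewrite ler_pM2l// /cost.
  by case: ifP => // _; rewrite ler_pXn2r// nnegrE ltW.
- move=> t tn; rewrite -mulrA -mulrDr -mulrA ler_pdivrMl//.
  by apply: le_trans (live t (central_itv tn)) _; rewrite ler_pM2l// /cost tn.
Qed.

Lemma tree_bound :
  #|F0|%:R * #|G0|%:R <= L * ((1 / 2 + z) ^+ 2) ^+ #|T|.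
Proof.
have wsum0 (x : T -> R) F : wsum finset.set0 x F = #|F|%:R.
  rewrite /wsum (eq_bigr (fun=> 1)) => [|A _]; first by rewrite sumr_const.
  by rewrite /weight finset.set0D big_set0.
have := @tree_step #|T| finset.setT finset.set0 (fun=> 1 / 2) F0 G0.
rewrite !wsum0 big_set0 mulr1; apply=> //.
- by rewrite cardsT.
- by rewrite -setI_eq0 finset.set0I.
- by move=> A _; rewrite finset.setUT finset.subsetT.
- by move=> A _; rewrite finset.setUT finset.subsetT.
- by move=> _; apply/andP; split; lra.
Qed.

End Tree.

(** * Estimates of the penalty *)

Section Bounds.
Context {R : realType}.

Lemma ln_itv_le0 (t : R) : t < 1 -> ln t <= 0.
Proof. by move=> t1; rewrite ln_le0// ltW. Qed.

Lemma ln2_bounds : 1 / 2 <= ln 2 :> R /\ ln 2 <= 1 :> R.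
Proof.
split; first by apply: le_trans (ln_ge_1subV _) => //; lra.
by have := @le_ln1Dx R 1; rewrite (_ : 1 + 1 = 2)//; apply; lra.
Qed.

Lemma ln3_bounds : 0 <= ln 3 :> R /\ ln 3 <= 2 :> R.
Proof.
split; first by apply: ln_ge0; lra.
by have := @le_ln1Dx R 2; rewrite (_ : 1 + 2 = 3); [apply; lra|lra].
Qed.

(** This is 2^11 < 3^7 with a margin.  It says that the penalty at
    p = q = x = 1/2, which is (ln 3 - ln 2)/4, is smaller than ln (9/8). *)
Lemma ln23_gap : 1 / 16 <= 7 * ln 3 - 11 * ln 2 :> R.
Proof.
have E : 7 * ln 3 - 11 * ln 2 = ln (3 ^+ 7 / 2 ^+ 11) :> R.
  by rewrite ln_div ?posrE ?exprn_gt0// !lnXn// !mulr_natl.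
rewrite E; apply: le_trans (ln_ge_1subV _); last by rewrite divr_gt0 ?exprn_gt0.
by rewrite invf_div lerBrDr -lerBrDl ler_pdivrMr ?exprn_gt0//; lra.
Qed.

Lemma ln98 : ln (9 / 8) = 2 * ln 3 - 3 * ln 2 :> R.
Proof.
rewrite (_ : 9 / 8 = 3 ^+ 2 / 2 ^+ 3); last by field.
by rewrite ln_div ?posrE ?exprn_gt0// !lnXn// !mulr_natl.
Qed.

Lemma ln98_ge : 1 / 9 <= ln (9 / 8) :> R.
Proof. by apply: le_trans (ln_ge_1subV _); rewrite ?invf_div//; lra. Qed.

Lemma ln_half_le (t : R) : 0 < t -> t <= 1 / 2 + 1 / 500 -> ln t <= - ln 2 + 1 / 250.
Proof.
move=> t0 th; have : ln (2 * t) <= 1 / 250.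
  have := @le_ln1Dx R (2 * t - 1); rewrite addrCA subrr addr0.
  by move=> /(_ ltac:(lra)); lra.
by rewrite lnM ?posrE//; lra.
Qed.

Lemma penalty_le (p q x : R) : 0 < x < 1 -> 0 <= p <= 1 -> 0 <= q <= 1 ->
  penalty p q x <= p * (1 - q) * ln 3.
Proof.
move=> /andP[x0 x1] /andP[p0 p1] /andP[q0 q1]; rewrite /penalty gerDl.
have lx : ln x <= 0 by exact: ln_itv_le0.
have ly : ln (1 - x) <= 0 by apply: ln_itv_le0; lra.
apply: mulr_ge0_le0; first by rewrite mulr_ge0// subr_ge0.
have := mulr_ge0_le0 q0 lx.
have : (1 - q) * ln (1 - x) <= 0 by rewrite mulr_ge0_le0// subr_ge0.
by clear; lra.
Qed.

Lemma penalty_le_ln3 (p q x : R) : 0 < x < 1 -> 0 <= p <= 1 -> 0 <= q <= 1 ->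
  penalty p q x <= ln 3.
Proof.
move=> x01 p01 q01; apply: le_trans (penalty_le x01 p01 q01) _.
have [L3 _] := ln3_bounds; case/andP: p01 q01 => p0 p1 /andP[q0 q1].
by rewrite ler_piMl// mulr_ile1//; lra.
Qed.

Lemma penalty_center (p q x : R) : 0 <= p <= 1 -> 0 <= q <= 1 ->
  `|x - 1 / 2| <= 1 / 500 -> `|p - 1 / 2| <= 1 / 250 -> `|q - 1 / 2| <= 1 / 250 ->
  penalty p q x <= ln (9 / 8).
Proof.
move=> /andP[p0 p1] /andP[q0 q1] xn pn qn.
have [[L3 L3'] [L2 L2']] := (ln3_bounds, ln2_bounds); have gap := ln23_gap.
rewrite ln98 /penalty.
move: xn pn qn; rewrite !ler_norml => /andP[xn xn'] /andP[pn pn'] /andP[qn qn'].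
have lx : ln x <= - ln 2 + 1 / 250 by apply: ln_half_le; move: xn xn'; clear; lra.
have ly : ln (1 - x) <= - ln 2 + 1 / 250.
  by apply: ln_half_le; move: xn xn'; clear; lra.
move: (ln x) (ln (1 - x)) lx ly => lx ly hx hy.
have h1 : q * lx + (1 - q) * ly <= - ln 2 + 1 / 250.
  have := ler_wpM2l q0 hx; have := @ler_wpM2l _ (1 - q) _ _ _ hy.
  by rewrite subr_ge0 => /(_ q1); clear; lra.
move: (q * lx + (1 - q) * ly) h1 => l h1.
have pp : p * (1 - p) = 1 / 4 - (p - 1 / 2) ^+ 2 by field.
have ps : (p - 1 / 2) ^+ 2 <= (1 / 250) ^+ 2.
  rewrite -subr_ge0 subr_sqr; apply: mulr_ge0.
    by move: pn'; clear; lra.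
  by move: pn; clear; lra.
have pl : 6 / 25 <= p * (1 - p) by rewrite pp; move: ps; clear; lra.
have h2 : p * (1 - p) * l <= (1 / 4 - (1 / 250) ^+ 2) * (- ln 2 + 1 / 250).
  apply: (@le_trans _ _ (p * (1 - p) * (- ln 2 + 1 / 250))).
    by apply: ler_wpM2l => //; apply: le_trans pl; clear; lra.
  rewrite pp; apply: ler_wnM2r; first by move: L2; clear; lra.
  by rewrite lerD2l lerN2.
have h3 : p * (1 - q) <= (1 / 2 + 1 / 250) * (1 / 2 + 1 / 250).
  apply: ler_pM; [exact: p0|by rewrite subr_ge0| |].
    by move: pn'; clear; lra.
  by move: qn; clear; lra.
have h4 := ler_wpM2r L3 h3.
by move: h2 h4 L2' L3' gap; clear; lra.
Qed.

(** If q is near 1 the penalty is small, being at most (1 - q) ln 3.  If p or q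
    is far from the value prescribed by x, the gain from tilting exceeds 2 lam,
    which dominates the penalty; this is where lam must be tiny compared with
    (1/500)^2.  Otherwise p and q are both near 1/2 and penalty_center
    applies. *)
Lemma penalty_near (p q x lam : R) : 0 <= p <= 1 -> 0 <= q <= 1 ->
  `|x - 1 / 2| <= 1 / 500 -> 0 <= lam <= (1 / 100) ^+ 4 ->
  lam * penalty p q x <= lam * ln (9 / 8) +
    (1 - q) * ((p - (1 - x)) ^+ 2 / 8) +
    (1 - lam) * ((1 - p) * ((q - x) ^+ 2 / 8)).
Proof.
move=> p01 q01 xn /andP[lam0 lam1].
have [[L3 L3'] L98] := (ln3_bounds, ln98_ge).
have := xn; rewrite ler_norml => /andP[xl xr].
have x01 : 0 < x < 1 by apply/andP; move: xl xr; clear; split; lra.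
have /andP[p0 p1] := p01; have /andP[q0 q1] := q01.
have lamh : lam <= 1 / 2 by move: lam1; clear; lra.
have g1 : 0 <= (1 - q) * ((p - (1 - x)) ^+ 2 / 8).
  by rewrite mulr_ge0 ?subr_ge0// divr_ge0 ?sqr_ge0.
have g2 : 0 <= (1 - lam) * ((1 - p) * ((q - x) ^+ 2 / 8)).
  apply: mulr_ge0; first by move: lamh; clear; lra.
  by rewrite mulr_ge0 ?subr_ge0// divr_ge0 ?sqr_ge0.
have easy : penalty p q x <= ln (9 / 8) -> lam * penalty p q x <=
    lam * ln (9 / 8) + (1 - q) * ((p - (1 - x)) ^+ 2 / 8) +
    (1 - lam) * ((1 - p) * ((q - x) ^+ 2 / 8)).
  move=> /(ler_wpM2l lam0); move: (g1) (g2); clear; lra.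
have pen2 : lam * penalty p q x <= lam * 2.
  by apply: ler_wpM2l => //; apply: le_trans L3'; exact: penalty_le_ln3.
have l98 : 0 <= lam * ln (9 / 8).
  by rewrite mulr_ge0//; apply: le_trans L98; clear; lra.
have sq (t : R) : 1 / 500 < `|t| -> 1 / 500 / 500 <= t ^+ 2.
  move=> ht; rewrite -real_normK ?num_real//.
  rewrite (_ : 1 / 500 / 500 = (1 / 500) ^+ 2); last by field.
  rewrite -subr_ge0 subr_sqr; apply: mulr_ge0.
    by move: ht; clear; lra.
  by move: ht; clear; lra.
have [uq|uq] := lerP (1 - q) (1 / 18).
  apply: easy; apply: le_trans (penalty_le x01 p01 q01) _; apply: le_trans L98.
  have : p * (1 - q) * ln 3 <= 1 / 18 * 2.
    apply: ler_pM => //; first by rewrite mulr_ge0// subr_ge0.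
    by apply: le_trans uq; rewrite ler_piMl// subr_ge0.
  by clear; lra.
have [pn|pn] := lerP `|p - (1 - x)| (1 / 500); last first.
  have : 1 / 18 * (1 / 500 / 500 / 8) <= (1 - q) * ((p - (1 - x)) ^+ 2 / 8).
    apply: ler_pM; [clear; lra|clear; lra|exact: ltW|].
    by have := sq _ pn; clear; lra.
  by move: pen2 l98 g2 lam1; clear; lra.
have [qn|qn] := lerP `|q - x| (1 / 500).
  apply/easy/penalty_center => //.
  - by move: pn xl xr; rewrite !ler_norml => /andP[+ +]; clear; move=> *;
      apply/andP; split; lra.
  - by move: qn xl xr; rewrite !ler_norml => /andP[+ +]; clear; move=> *;
      apply/andP; split; lra.
have pq : 1 / 4 <= 1 - p.
  by move: pn; rewrite ler_norml => /andP[_]; move: xl; clear; lra.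
have : 1 / 2 * (1 / 4 * (1 / 500 / 500 / 8)) <=
    (1 - lam) * ((1 - p) * ((q - x) ^+ 2 / 8)).
  apply: ler_pM; [clear; lra|clear; lra|move: lamh; clear; lra|].
  apply: ler_pM; [clear; lra|clear; lra|exact: pq|].
  by have := sq _ qn; clear; lra.
by move: pen2 l98 g1 lam1; clear; lra.
Qed.

End Bounds.

(** * Upper bounds for cancellative and recovering pairs *)

Section Cancellative.
Variables (n : nat) (FA FB : {set {set 'I_n}}).
Hypothesis canc : cancellative FA FB.

Lemma cancellative_injl (S : {set 'I_n}) :
  {in FA, forall A : {set 'I_n}, A \subset S} ->
  {in FB, forall B, {in FA &, injective (fun A => A :&: (S :\: B))}}.
Proof.
move=> sS B BB A A' AA A'A /finset.setP E; case/andP: canc => /forall_inP c _.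
move/forall_inP: (c A AA) => /(_ A' A'A)/forall_inP/(_ B BB)/implyP c'.
apply/eqP/c'/eqP/finset.setP => i; have := E i; rewrite !inE.
have := fintype.subsetP (sS A AA) i; have := fintype.subsetP (sS A' A'A) i.
case: (i \in A); case: (i \in A'); case: (i \in B) => //=.
- by move=> _ ->.
- by move=> -> // _.
Qed.

Lemma cancellative_injr (S : {set 'I_n}) :
  {in FB, forall B : {set 'I_n}, B \subset S} ->
  {in FA, forall A, {in FB &, injective (fun B => B :&: (S :\: A))}}.
Proof.
move=> sS A AA B B' BB B'B /finset.setP E; case/andP: canc => _ /forall_inP c.
move/forall_inP: (c A AA) => /(_ B BB)/forall_inP/(_ B' B'B)/implyP c'.
apply/eqP/c'/eqP/finset.setP => i; have := E i; rewrite !inE.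
have := fintype.subsetP (sS B BB) i; have := fintype.subsetP (sS B' B'B) i.
case: (i \in B); case: (i \in B'); case: (i \in A) => //=.
- by move=> _ ->.
- by move=> -> // _.
Qed.

End Cancellative.

Lemma cancellative_sub n (FA FB F G : {set {set 'I_n}}) :
  F \subset FA -> G \subset FB -> cancellative FA FB -> cancellative F G.
Proof.
move=> /fintype.subsetP sF /fintype.subsetP sG /andP[/forall_inP c1 /forall_inP c2].
apply/andP; split; apply/forall_inP => A AF; apply/forall_inP => C CF;
  apply/forall_inP => D DF.
  move/forall_inP: (c1 A (sF A AF)) => /(_ C (sF C CF))/forall_inP; apply.
  exact: sG.
move/forall_inP: (c2 A (sF A AF)) => /(_ C (sG C CF))/forall_inP; apply.
exact: sG.
Qed.

Lemma recoveringP n (FA FB : {set {set 'I_n}}) :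
  reflect ({in FA &, forall A A', {in FB &, forall B B',
      (A :\: B = A' :\: B' -> A = A') /\ (B :\: A = B' :\: A' -> B = B')}})
    (recovering FA FB).
Proof.
apply: (iffP idP) => [/forall_inP r A A' AA A'A B B' BB B'B | r].
  move/forall_inP: (r A AA) => /(_ A' A'A)/forall_inP/(_ B BB)/forall_inP.
  move=> /(_ B' B'B)/andP[/implyP r1 /implyP r2].
  by split=> /eqP E; apply/eqP; [exact: r1|exact: r2].
apply/forall_inP => A AA; apply/forall_inP => A' A'A.
apply/forall_inP => B BB; apply/forall_inP => B' B'B.
have [r1 r2] := r A A' AA A'A B B' BB B'B.
by apply/andP; split; apply/implyP => /eqP E; apply/eqP; [exact: r1|exact: r2].
Qed.

Lemma recovering_sym n (FA FB : {set {set 'I_n}}) :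
  recovering FA FB -> recovering FB FA.
Proof.
move=> /recoveringP r; apply/recoveringP => B B' BB B'B A A' AA A'A.
by have [] := r A A' AA A'A B B' BB B'B.
Qed.

Lemma recovering_cancellative n (FA FB : {set {set 'I_n}}) :
  recovering FA FB -> cancellative FA FB.
Proof.
move=> /recoveringP r.
have E (A A' B : {set 'I_n}) : A :|: B = A' :|: B -> A :\: B = A' :\: B.
  by move=> e; rewrite -[A :\: B]finset.setU0 -(finset.setDv B) -finset.setDUl
    e finset.setDUl finset.setDv finset.setU0.
apply/andP; split; apply/forall_inP => A AA; apply/forall_inP => C CC;
  apply/forall_inP => D DD; apply/implyP => /eqP e; apply/eqP.
  by have [+ _] := r A C AA CC D D DD DD; apply; exact: E.
have [_] := r A A AA AA C D CC DD; apply; apply: E.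
by rewrite ![_ :|: A]finset.setUC.
Qed.

Lemma sum_exp_card (R : comPzRingType) (T : finType) (c : R) :
  \sum_(V : {set T}) c ^+ #|V| = (c + 1) ^+ #|T|.
Proof.
pose f (_ : T) := c; pose g (_ : T) : R := 1.
transitivity (\prod_i (f i + g i)); last by rewrite /f /g prodr_const.
rewrite bigA_distr; apply: eq_bigr => V _.
by rewrite -big_mkcond /= prodr_const.
Qed.

Section UpperBounds.
Context {R : realType}.

Lemma cancellative_bound n (FA FB : {set {set 'I_n}}) : cancellative FA FB ->
  #|FA|%:R * #|FB|%:R <= (9 / 4) ^+ n :> R.
Proof.
move=> canc.
pose M : R := 1 + \sum_(A in FA) trace_weight FB A.
have M0 : 0 < M.
  by rewrite ltr_wpDr// sumr_ge0// => A _; exact: trace_weight_ge0.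
rewrite -[leRHS]mul1r (_ : 9 / 4 = (1 / 2 + 1) ^+ 2); last by field.
rewrite -[X in _ ^+ X](card_ord n).
apply: (@tree_bound R 'I_n 1 1 1 FA FB) => //; [by clear; lra|by clear; lra|].
move=> S x F G sF sG FS GS xB.
have cFG := cancellative_sub sF sG canc.
have x01 i : 0 < x i < 1.
  by have /andP[h1 h2] := xB i; apply/andP; split; move: h1 h2; clear; lra.
rewrite big1 => [|i _]; last by rewrite /cost expr1n if_same.
have := @leaf_bound R _ S x (fun=> 0) F G 0 M x01.
rewrite mul0r add0r big1// expR0 mulr1; apply=> //.
- by rewrite lexx ler01.
- exact: (cancellative_injr cFG).
- exact: (cancellative_injl cFG).
- move=> A AF; apply: le_trans (trace_weight_sub _ sG) _.
  have AFA := fintype.subsetP sF A AF.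
  rewrite /M (bigD1 A)//= addrCA lerDl addr_ge0// sumr_ge0// => B _.
  exact: trace_weight_ge0.
- move=> i p q /andP[p0 p1] /andP[q0 q1].
  by rewrite mul0r add0r subr0 mul1r addr_ge0// mulr_ge0 ?subr_ge0//
    divr_ge0 ?sqr_ge0.
Qed.

Lemma expR_le_1D2 (t : R) : 0 <= t <= 1 / 2 -> expR t <= 1 + 2 * t.
Proof.
move=> /andP[t0 t1]; have H := expR_ge1Dx (- t).
rewrite -[t]opprK expRN -[leRHS]invrK opprK lef_pV2 ?posrE ?invr_gt0 ?expR_gt0//.
  apply: le_trans H; rewrite -[leLHS]mul1r ler_pdivrMr; last by lra.
  have : 0 <= t * (1 / 2 - t) by rewrite mulr_ge0// subr_ge0.
  by clear; lra.
by lra.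
Qed.

(** Compared with cancellative_bound, deleted coordinates cost nothing more and
    weighted ones cost a factor (9/8)^lam near weight 1/2; at the other weights
    the trivial bound 3^lam on the loss is good enough. *)
Lemma trace_cancellative_bound n (FA FB : {set {set 'I_n}}) (M lam : R) :
  cancellative FA FB -> 0 < M -> {in FA, forall A, trace_weight FB A <= M} ->
  0 <= lam <= (1 / 100) ^+ 4 ->
  #|FA|%:R * #|FB|%:R <=
  expR (lam * ln M) * ((1 / 2 + expR (lam / 2 * ln (9 / 8))) ^+ 2) ^+ n.
Proof.
move=> canc M0 trM lamB; have /andP[lam0 lam1] := lamB.
have [[L3 L3'] L98] := (@ln3_bounds R, @ln98_ge R).
set z := expR (lam / 2 * ln (9 / 8)); pose Z := expR (lam / 2 * ln 3).
have lam2 : 0 <= lam / 2 by rewrite divr_ge0.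
have z1 : 1 <= z.
  rewrite -[leLHS]expR0 /z ler_expR mulr_ge0//.
  by apply: le_trans L98; clear; lra.
have zZ : z <= Z.
  by rewrite ler_expR ler_wpM2l// ler_ln ?posrE; clear; lra.
have tB : lam / 2 * ln 3 <= lam.
  by have := ler_wpM2l lam2 L3'; clear; lra.
have Z2 : Z <= 1 + 2 * lam.
  have : Z <= 1 + 2 * (lam / 2 * ln 3).
    apply: expR_le_1D2; apply/andP; split; first by rewrite mulr_ge0.
    by move: tB lam1; clear; lra.
  by move: tB; clear; lra.
have ZB : Z <= 101 / 100 by move: Z2 lam1; clear; lra.
have := @tree_bound R 'I_n z Z (expR (lam * ln M)) FA FB z1 zZ ZB.
rewrite card_ord; apply; [|exact: expR_gt0|].
  have : (1 / 2 + Z) ^+ 2 <= (1 / 2 + (1 + 2 * lam)) ^+ 2.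
    rewrite -subr_ge0 subr_sqr; apply: mulr_ge0; first by move: Z2; clear; lra.
    by move: z1 zZ lam0; clear; lra.
  have : (1 / 2 + 1) ^+ 2 <= (1 / 2 + z) ^+ 2.
    rewrite -subr_ge0 subr_sqr; apply: mulr_ge0; move: z1; clear; lra.
  have : lam ^+ 2 <= lam.
    rewrite expr2 ler_piMr//; move: lam1; clear; lra.
  by move: lam1; clear; lra.
move=> S x F G sF sG FS GS xB.
have cFG := cancellative_sub sF sG canc.
have x01 i : 0 < x i < 1.
  by have /andP[h1 h2] := xB i; apply/andP; split; move: h1 h2; clear; lra.
pose c i := if `|x i - 1 / 2| <= 1 / 500 then lam * ln (9 / 8) else lam * ln 3.
have -> : \prod_(i in S) cost z Z (x i) = expR (\sum_(i in S) c i).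
  rewrite expR_sum; apply: eq_bigr => i _; rewrite /cost /c /z /Z.
  by case: ifP => _; rewrite -expRM_natl; congr expR; field.
rewrite -expRD; apply: leaf_bound => //.
- by apply/andP; split=> //; move: lam1; clear; lra.
- exact: (cancellative_injr cFG).
- exact: (cancellative_injl cFG).
- move=> A AF; apply: le_trans (trace_weight_sub _ sG) _.
  exact: trM (fintype.subsetP sF A AF).
- move=> i p q p01 q01; rewrite /c; case: ifP => [xn|_]; first exact: penalty_near.
  have /(ler_wpM2l lam0) H := penalty_le_ln3 (x01 i) p01 q01.
  have [/andP[p0 p1] /andP[q0 q1]] := (p01, q01).
  have g1 : 0 <= (1 - q) * ((p - (1 - x i)) ^+ 2 / 8).
    by rewrite mulr_ge0 ?subr_ge0// divr_ge0 ?sqr_ge0.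
  have g2 : 0 <= (1 - lam) * ((1 - p) * ((q - x i) ^+ 2 / 8)).
    apply: mulr_ge0; first by move: lam1; clear; lra.
    by rewrite mulr_ge0 ?subr_ge0// divr_ge0 ?sqr_ge0.
  by move: (H) (g1) (g2); clear; lra.
Qed.

(** For a recovering pair, A \ B determines A and hence also A intersected with
    B, so the summands run over distinct sets V = A \ U. *)
Lemma sum_trace_weight n (FA FB : {set {set 'I_n}}) : recovering FA FB ->
  \sum_(A in FA) trace_weight FB A <= (4 / 3) ^+ n :> R.
Proof.
move=> /recoveringP r; rewrite /trace_weight pair_big_dep /=.
pose h (p : {set 'I_n} * {set 'I_n}) := p.1 :\: p.2.
pose D := [set p : {set 'I_n} * {set 'I_n} |
  (p.1 \in FA) && (p.2 \in [set p.1 :&: B | B in FB])].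
have hinj : {in D &, injective h}.
  move=> [A U] [A' U']; rewrite !inE /= => /andP[AA /imsetP[B BB ->]].
  move=> /andP[A'A /imsetP[B' B'B ->]]; rewrite /h /= !finset.setDIr !finset.setDv.
  rewrite !finset.set0U => E.
  have [/(_ E) EA _] := r A A' AA A'A B B' BB B'B; subst A'; congr pair.
  have e C : A :&: C = A :\: (A :\: C).
    by rewrite finset.setDDr finset.setDv finset.set0U.
  by rewrite e E -e.
have -> : (4 / 3) ^+ n = \sum_(V : {set 'I_n}) 3^-1 ^+ #|V| :> R.
  by rewrite sum_exp_card card_ord; congr (_ ^+ _); field.
rewrite (eq_bigl (mem D)) => [|p]; last by rewrite !inE.
rewrite -(@big_imset _ _ _ _ _ h _ (fun V => 3^-1 ^+ #|V|) hinj) /=.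
rewrite [leRHS](bigID (mem (h @: D))) /= lerDl sumr_ge0// => V _.
Qed.

(** By sum_trace_weight the average trace weight is at most (4/3)^n / #|FA|;
    restrict FA to the sets of at most twice this trace weight and apply
    trace_cancellative_bound.  The term lam / 2 on the left comes from #|FA|
    being at least the square root of the product. *)
Lemma recovering_bound_le n (FA FB : {set {set 'I_n}}) (lam : R) :
  recovering FA FB -> 0 <= lam <= (1 / 100) ^+ 4 ->
  (0 < #|FB|)%N -> (#|FB| <= #|FA|)%N ->
  (1 + lam / 2) * ln (#|FA| * #|FB|)%:R <=
  2 * ln 2 + n%:R * (lam * ln (4 / 3) + 2 * ln (1 / 2 + expR (lam / 2 * ln (9 / 8)))).
Proof.
move=> r lamB B0 BA; have A0 := leq_trans B0 BA.
have /andP[lam0 lam1] := lamB.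
have [NA NB] : 0 < #|FA|%:R :> R /\ 0 < #|FB|%:R :> R by rewrite !ltr0n.
pose M : R := 2 * (4 / 3) ^+ n / #|FA|%:R.
have M0 : 0 < M by rewrite divr_gt0// mulr_gt0// exprn_gt0.
pose F := [set A in FA | trace_weight FB A <= M].
have FF : F \subset FA by apply/fintype.subsetP => A; rewrite inE => /andP[].
(* Markov: the sets of large trace weight are at most half of the family *)
have half : #|FA|%:R / 2 <= #|F|%:R :> R.
  have cD : #|FA|%:R = #|F|%:R + #|FA :\: F|%:R :> R.
    by rewrite -natrD -(cardsID F FA) (finset.setIidPr FF).
  suff : #|FA :\: F|%:R <= #|FA|%:R / 2 :> R by move: cD; clear; lra.
  have qM : #|FA|%:R / 2 * M = (4 / 3) ^+ n by rewrite /M; field; rewrite gt_eqF.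
  rewrite -(ler_pM2r M0) qM.
  apply: le_trans (sum_trace_weight r).
  rewrite mulr_natl -sumr_const [leRHS](bigID (mem F)) /= -[leLHS]add0r lerD//.
    by apply: sumr_ge0 => A _; exact: trace_weight_ge0.
  rewrite (eq_bigl (fun A => (A \in FA) && (A \notin F))); last first.
    by move=> A; rewrite !inE andbC.
  by apply: ler_sum => A /andP[AA]; rewrite inE AA /= -ltNge; exact: ltW.
have cF := cancellative_sub FF (fintype.subxx _) (recovering_cancellative r).
have trF : {in F, forall A, trace_weight FB A <= M}.
  by move=> A; rewrite inE => /andP[].
have := le_trans (ler_wpM2r (ltW NB) half) (trace_cancellative_bound cF M0 trF lamB).
set w := 1 / 2 + expR _.
have w0 : 0 < w by rewrite addr_gt0 ?expR_gt0// divr_gt0.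
have q0 : 0 < (4 / 3) ^+ n :> R by rewrite exprn_gt0// divr_gt0.
have w2 : 0 < (w ^+ 2) ^+ n by rewrite !exprn_gt0.
have EM : ln M = ln 2 + n%:R * ln (4 / 3) - ln #|FA|%:R.
  by rewrite /M ln_div ?posrE// ?mulr_gt0// lnM ?posrE// lnXn ?divr_gt0// [n%:R * _]mulr_natl.
have El : ln (#|FA|%:R / 2 * #|FB|%:R) = ln #|FA|%:R - ln 2 + ln #|FB|%:R :> R.
  by rewrite lnM ?posrE ?divr_gt0// ln_div ?posrE.
have Er : ln (expR (lam * ln M) * (w ^+ 2) ^+ n) = lam * ln M + n%:R * (2 * ln w).
  rewrite lnM ?posrE ?expR_gt0// expRK lnXn ?exprn_gt0// lnXn//.
  by rewrite -[ln w *+ 2]mulr_natl -[_ *+ n]mulr_natl.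
rewrite -[X in is_true X -> _]ler_ln ?posrE; last 2 first.
- by rewrite mulr_gt0 ?divr_gt0.
- by rewrite mulr_gt0 ?expR_gt0.
rewrite El Er EM.
rewrite natrM lnM ?posrE//.
have hl : ln #|FB|%:R <= ln #|FA|%:R :> R by rewrite ler_ln ?posrE// ler_nat.
have [L2 L2'] := @ln2_bounds R.
move=> H; have h1 := ler_wpM2l lam0 hl.
have h2 : lam * ln 2 <= ln 2 :> R.
  by rewrite ler_piMl//; move: L2 lam1; clear; lra.
by move: H h1 h2; clear; lra.
Qed.

(** With z = (9/8)^(lam/2) > 1, the inequality (1/2 + z)^2 < (9/4) z^2 makes the
    rate in recovering_bound_le strictly smaller than (1 + lam/2) ln (9/4). *)
Lemma recovering_bound : exists2 g : R, g < ln (9 / 4) &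
  forall n (FA FB : {set {set 'I_n}}), recovering FA FB ->
    (0 < #|FA|)%N -> (0 < #|FB|)%N ->
    ln (#|FA| * #|FB|)%:R <= 2 * ln 2 + n%:R * g.
Proof.
pose lam : R := (1 / 100) ^+ 4.
have lam0 : 0 < lam by rewrite exprn_gt0// divr_gt0.
have l1 : 0 < 1 + lam / 2 by rewrite addr_gt0// divr_gt0.
pose z : R := expR (lam / 2 * ln (9 / 8)).
pose h := lam * ln (4 / 3) + 2 * ln (1 / 2 + z).
exists (h / (1 + lam / 2)).
  rewrite ltr_pdivrMr//.
  have z1 : 1 < z.
    by rewrite expR_gt1 mulr_gt0 ?divr_gt0// ln_gt0//; clear; lra.
  have : ln (1 / 2 + z) < ln (3 / 2) + lam / 2 * ln (9 / 8).
    rewrite -[lam / 2 * _]expRK -/z -lnM ?posrE ?expR_gt0//.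
    rewrite ltr_ln ?posrE ?mulr_gt0 ?expR_gt0 ?addr_gt0// ?expR_gt0//.
    by move: z1; clear; lra.
  have e1 : ln (9 / 8) = ln (3 / 2) - ln (4 / 3) :> R.
    by rewrite -ln_div ?posrE ?divr_gt0//; congr ln; field.
  have -> : ln (9 / 4) = 2 * ln (3 / 2) :> R.
    by rewrite [2 * _]mulr_natl -lnXn ?divr_gt0//; congr ln; field.
  by rewrite /h e1; clear; lra.
move=> n FA FB r A0 B0; have [L2 L2'] := @ln2_bounds R.
have key (F G : {set {set 'I_n}}) : recovering F G -> (0 < #|G|)%N ->
    (#|G| <= #|F|)%N ->
    ln (#|F| * #|G|)%:R <= 2 * ln 2 + n%:R * (h / (1 + lam / 2)).
  move=> rFG G0 GF.
  have := @recovering_bound_le n F G lam rFG _ G0 GF.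
  rewrite lexx ltW// => /(_ isT); rewrite -/z -/h.
  rewrite mulrC -ler_pdivlMr// => /le_trans; apply.
  rewrite mulrDl mulrA lerD2r ler_pdivrMr// ler_peMr ?mulr_ge0//.
    by move: L2; clear; lra.
  by rewrite lerDl divr_ge0// ltW.
case: (leqP #|FB| #|FA|) => [|/ltnW] BA; first exact: key.
by rewrite mulnC; apply: key => //; exact: recovering_sym.
Qed.

End UpperBounds.

(** * Large cancellative pairs from random vectors *)

Section RandomColumns.
Variables (n : nat) (V : finZmodType).
Implicit Types (A D : {set 'I_n}) (c : {ffun 'I_n -> V}).

Definition syndrome c D : V := \sum_(i in D) c i.

Lemma syndromeD c A A' : syndrome c A = syndrome c (A :\: A') + syndrome c (A :&: A').
Proof.
by rewrite /syndrome (big_setID A') /= addrC.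
Qed.

(** Translating the vector of one coordinate of D permutes the fibers. *)
Lemma card_syndrome_fiber D (v : V) : D != finset.set0 ->
  #|[set c | syndrome c D == v]| = #|[set c | syndrome c D == 0]|.
Proof.
move=> /set0Pn[i0 i0D].
pose shift v c := [ffun i => c i + (if i == i0 then v else 0)] : {ffun 'I_n -> V}.
have shiftK u : cancel (shift u) (shift (- u)).
  by move=> c; apply/ffunP => i; rewrite !ffunE; case: eqP => _;
    rewrite ?addrK ?addr0.
have synS u c : syndrome (shift u c) D = syndrome c D + u.
  rewrite /syndrome; under eq_bigr do rewrite ffunE.
  rewrite big_split /=; congr (_ + _).
  by rewrite -big_mkcondr /= (big_pred1 i0)// => i /=;
    case: eqP => [->|_]; rewrite ?i0D ?andbF.
rewrite -(card_imset _ (can_inj (shiftK (- v)))); apply: eq_card => c.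
rewrite inE; apply/imsetP/eqP => [[c'] | c0].
  by rewrite inE => /eqP + ->; rewrite synS => ->; rewrite subrr.
exists (shift v c); first by rewrite inE synS c0 add0r.
by rewrite -{1}[c](shiftK v).
Qed.

Lemma card_syndrome0 D : D != finset.set0 ->
  (#|[set c | syndrome c D == 0%R]| * #|V| = #|{: {ffun 'I_n -> V}}|)%N.
Proof.
move=> D0; rewrite -[RHS]sum1_card (partition_big (syndrome^~ D) predT)//=.
rewrite (eq_bigr (fun=> #|[set c | syndrome c D == 0%R]|)) => [|v _].
  by rewrite sum_nat_const mulnC.
by rewrite sum1_card -(card_syndrome_fiber v D0); apply: eq_card => c; rewrite inE.
Qed.

Definition independent c A : bool :=
  [forall D in powerset A, (D != finset.set0) ==> (syndrome c D != 0)].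

(** Union bound: each of the fewer than 2^|A| nonempty subsets of A has vector
    sum 0 with probability 1 / #|V|, at most 1 / 2^(|A| + 1). *)
Lemma card_independent A : (2 ^ #|A|.+1 <= #|V|)%N ->
  (#|{: {ffun 'I_n -> V}}| <= 2 * #|[set c | independent c A]|)%N.
Proof.
move=> hV; set N := #|{: {ffun 'I_n -> V}}|.
have split : (#|[set c | independent c A]| + #|[set c | ~~ independent c A]| = N)%N.
  rewrite /N -(cardsC [set c | independent c A]); congr (_ + _)%N.
  by apply: eq_card => c; rewrite !inE.
have bad : (#|[set c | ~~ independent c A]| * #|V| <= 2 ^ #|A| * N)%N.
  have sub : [set c | ~~ independent c A] \subset
    \bigcup_(D in powerset A | D != finset.set0) [set c | syndrome c D == 0].
    apply/fintype.subsetP => c; rewrite inE => /forall_inPn[D DA].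
    rewrite negb_imply negbK => /andP[D0 cD].
    by apply/finset.bigcupP; exists D; rewrite ?DA ?inE.
  apply: (@leq_trans ((\sum_(D in powerset A | D != finset.set0)
      #|[set c | syndrome c D == 0%R]|) * #|V|)%N).
    rewrite leq_mul2r; apply/orP; right.
    apply: leq_trans (subset_leq_card sub) _.
    by elim/big_rec2: _ => [|D a B _ h]; rewrite ?cards0//
      (leq_trans (leq_card_setU _ _))// leq_add2l.
  rewrite big_distrl /= (eq_bigr (fun=> N)) => [|D /andP[_ D0]].
    rewrite sum_nat_const leq_mul2r -card_powerset; apply/orP; right.
    by apply/subset_leq_card/fintype.subsetP => D /andP[].
  exact: card_syndrome0.
have V0 : (0 < #|V|)%N by apply: leq_trans hV; rewrite expn_gt0.
have : (2 * #|[set c | ~~ independent c A]| <= N)%N.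
  rewrite -(leq_pmul2r V0) -mulnA (leq_trans (leq_mul (leqnn 2) bad))//.
  by rewrite mulnA -expnS mulnC leq_mul2l hV orbT.
by rewrite -split mul2n -addnn leq_add2r => h; rewrite mul2n -addnn leq_add2l.
Qed.

Definition coset_family (w : nat) c (s : V) : {set {set 'I_n}} :=
  [set A : {set 'I_n} | [&& #|A| == w, independent c A & syndrome c A == s]].

(** Averaging over all choices of vectors and of their prescribed sum. *)
Lemma large_coset_family w : (2 ^ w.+1 <= #|V|)%N ->
  exists c s, ('C(n, w) <= #|coset_family w c s| * (2 * #|V|))%N.
Proof.
move=> hV; pose m (p : {ffun 'I_n -> V} * V) := #|coset_family w p.1 p.2|.
set N := #|{: {ffun 'I_n -> V}}|.
have tot : ('C(n, w) * N <= 2 * \sum_p m p)%N.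
  have -> : (\sum_p m p =
      \sum_(A : {set 'I_n} | #|A| == w) #|[set c | independent c A]|)%N.
    rewrite -(pair_bigA _ (fun c s => m (c, s))) /=.
    under [RHS]eq_bigr do rewrite -sum1_card.
    under [RHS]eq_bigr do (under eq_bigl do rewrite inE).
    rewrite [RHS](exchange_big_dep predT)//=; apply: eq_bigr => c _.
    rewrite [RHS](partition_big (syndrome c) predT)//=; apply: eq_bigr => s _.
    by rewrite /m /= -sum1_card; apply: eq_bigl => A; rewrite inE andbA.
  have -> : 'C(n, w) = #|[set A : {set 'I_n} | #|A| == w]|.
    by rewrite card_draws card_ord.
  rewrite big_distrr /= -sum_nat_const /=.
  rewrite (eq_bigl (fun A : {set 'I_n} => #|A| == w)) => [|A]; last first.
    by rewrite inE.
  apply: leq_sum => A /eqP Aw; apply: card_independent; by rewrite Aw.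
have N0 : (0 < N)%N by apply/card_gt0P; exists [ffun=> 0].
have [p Ep] : {p | (\max_p m p)%N = m p}.
  by apply: bigop.eq_bigmax; apply/card_gt0P; exists ([ffun=> 0], 0).
exists p.1, p.2; rewrite -(leq_pmul2r N0); apply: leq_trans tot _.
have -> : (#|coset_family w p.1 p.2| * (2 * #|V|) * N = 2 * (m p * (N * #|V|)))%N.
  by rewrite /m; lia.
rewrite leq_mul2l /= -card_prod mulnC -sum_nat_const leq_sum// => q _.
by rewrite -Ep leq_bigmax.
Qed.

Lemma coset_family_cancellative (w : nat) c s : (forall v : V, v + v = 0) ->
  cancellative (coset_family w c s) (coset_family w c s).
Proof.
move=> V2.
have key A A' B : A \in coset_family w c s -> A' \in coset_family w c s ->
    B \in coset_family w c s -> A :|: B = A' :|: B -> A = A'.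
  rewrite !inE => /and3P[_ _ /eqP sA] /and3P[_ _ /eqP sA'] /and3P[_ iB _] E.
  pose D := (A :\: A') :|: (A' :\: A).
  have DB : D \subset B.
    apply/fintype.subsetP => i; have := congr1 (fun S : {set _} => i \in S) E.
    rewrite !inE.
    by case: (i \in A); case: (i \in A'); case: (i \in B).
  have D0 : syndrome c D = 0.
    rewrite (syndromeD c D A).
    have -> : D :\: A = A' :\: A.
      by apply/finset.setP => i; rewrite !inE; case: (i \in A); case: (i \in A').
    have -> : D :&: A = A :\: A'.
      by apply/finset.setP => i; rewrite !inE; case: (i \in A); case: (i \in A').
    have : syndrome c (A :\: A') = syndrome c (A' :\: A).
      apply: (@addIr _ (syndrome c (A :&: A'))).
      by rewrite -syndromeD finset.setIC -syndromeD sA sA'.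
    by move=> ->; exact: V2.
  have D00 : D = finset.set0.
    apply/eqP; apply: contraTT (iB) => Dn0; apply/forall_inPn.
    by exists D; rewrite ?powersetE// Dn0 D0 eqxx.
  apply/finset.setP => i; have := congr1 (fun S : {set _} => i \in S) D00.
  by rewrite !inE; case: (i \in A); case: (i \in A').
apply/andP; split; apply/forall_inP => A AF; apply/forall_inP => A' AF';
  apply/forall_inP => B BF; apply/implyP => /eqP E; apply/eqP.
  exact: key E.
by apply: (key _ _ A) => //; rewrite ![_ :|: A]finset.setUC.
Qed.

End RandomColumns.

Lemma cancellative_lower n :
  exists F : {set {set 'I_n}}, cancellative F F /\
    (3 ^ n <= #|F| * (4 * 2 ^ n * n.+1))%N.
Proof.
have [w Ew] : exists w : 'I_n.+1, (3 ^ n <= n.+1 * (2 ^ (n - w) * 'C(n, w)))%N.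
  have -> : (3 = 2 + 1)%N by [].
  rewrite expnDn; pose m (i : 'I_n.+1) := ('C(n, i) * (2 ^ (n - i) * 1 ^ i))%N.
  have [w Ew] : {w | (\max_i m i)%N = m w} by apply: bigop.eq_bigmax; rewrite card_ord.
  exists w; rewrite [(2 ^ _ * _)%N]mulnC.
  have -> : ('C(n, w) * 2 ^ (n - w) = m w)%N by rewrite /m exp1n muln1.
  rewrite -Ew -[X in (_ <= X * _)%N](card_ord n.+1) -sum_nat_const.
  by apply: leq_sum => i _; exact: leq_bigmax.
pose V := 'rV['F_2]_(w.+1).
have cV : #|{: V}| = (2 ^ w.+1)%N by rewrite card_mx card_Fp// mul1n.
have [c [s h]] := @large_coset_family n V w (eq_leq (esym cV)).
exists (coset_family w c s); split.
  apply: coset_family_cancellative => v; apply/rowP => j; rewrite !mxE.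
  by apply: addrr_pchar2; exact: pchar_Fp.
apply: leq_trans Ew _.
apply: (leq_trans (leq_mul (leqnn _) (leq_mul (leqnn _) h))).
have wn : (w <= n)%N by rewrite -ltnS.
have e : (2 ^ n = 2 ^ (n - w) * 2 ^ w)%N by rewrite -expnD subnK.
by rewrite cV e expnS; lia.
Qed.

(** * Growth rates *)

Section Glue.
Variables m n : nat.

Definition glue (p : {set 'I_m} * {set 'I_n}) : {set 'I_(m + n)} :=
  [set i : 'I_(m + n) | match fintype.split i with inl j => j \in p.1 | inr j => j \in p.2 end].

Lemma glue_inj : injective glue.
Proof.
move=> [A A'] [B B'] E; congr pair; apply/finset.setP => j.
  have := congr1 (fun S : {set _} => unsplit (inl j) \in S) E.
  by rewrite !inE unsplitK.
have := congr1 (fun S : {set _} => unsplit (inr j) \in S) E.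
by rewrite !inE unsplitK.
Qed.

Lemma glueD p q : glue p :\: glue q = glue (p.1 :\: q.1, p.2 :\: q.2).
Proof. by apply/finset.setP => i; rewrite !inE; case: (fintype.split i) => j; rewrite !inE. Qed.

Definition glue_families (F : {set {set 'I_m}}) (F' : {set {set 'I_n}}) :=
  [set glue p | p in finset.setX F F'].

Lemma card_glue_families F F' : #|glue_families F F'| = (#|F| * #|F'|)%N.
Proof. by rewrite card_imset ?cardsX//; exact: glue_inj. Qed.

(** The differences of glued sets are the glued differences. *)
Lemma recovering_glue FA FB FA' FB' : recovering FA FB -> recovering FA' FB' ->
  recovering (glue_families FA FA') (glue_families FB FB').
Proof.
move=> /recoveringP r /recoveringP r'; apply/recoveringP.
move=> ? ? /imsetP[[A A'] /finset.setXP[AA AA'] ->].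
move=> /imsetP[[C C'] /finset.setXP[CC CC'] ->].
move=> ? ? /imsetP[[B B'] /finset.setXP[BB BB'] ->].
move=> /imsetP[[D D'] /finset.setXP[DD DD'] ->] /=; rewrite !glueD /=.
have [r1 r2] := r A C AA CC B D BB DD; have [r1' r2'] := r' A' C' AA' CC' B' D' BB' DD'.
by split=> /glue_inj[e e']; congr (glue (_, _)); auto.
Qed.

End Glue.

Lemma leq_max_can n (FA FB : {set {set 'I_n}}) :
  cancellative FA FB -> (#|FA| * #|FB| <= max_can n)%N.
Proof. by move=> c; exact: (@leq_bigmax_cond _ _ _ (FA, FB)). Qed.

Lemma leq_max_rec n (FA FB : {set {set 'I_n}}) :
  recovering FA FB -> (#|FA| * #|FB| <= max_rec n)%N.
Proof. by move=> c; exact: (@leq_bigmax_cond _ _ _ (FA, FB)). Qed.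

Lemma recovering_points n :
  recovering [set finset.set0 : {set 'I_n}] [set finset.set0 : {set 'I_n}].
Proof.
apply/recoveringP => A A' /finset.set1P -> /finset.set1P ->.
by move=> B B' /finset.set1P -> /finset.set1P ->.
Qed.

Lemma max_rec_gt0 n : (0 < max_rec n)%N.
Proof. by apply: leq_trans (leq_max_rec (recovering_points n)); rewrite !cards1. Qed.

Lemma max_rec_attained n : exists FA FB : {set {set 'I_n}},
  recovering FA FB /\ (#|FA| * #|FB|)%N = max_rec n.
Proof.
pose P := [pred p : {set {set 'I_n}} * {set {set 'I_n}} | recovering p.1 p.2].
have P0 : (0 < #|P|)%N.
  by apply/card_gt0P; exists ([set finset.set0], [set finset.set0]);
    exact: recovering_points.
have [[FA FB] r E] := bigop.eq_bigmax_cond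
  (fun p : {set {set 'I_n}} * {set {set 'I_n}} => #|p.1| * #|p.2|)%N P0.
by exists FA, FB; split; [|rewrite -[RHS]/(\max_(p in P) _)%N E].
Qed.

Lemma max_can_attained n : exists FA FB : {set {set 'I_n}},
  cancellative FA FB /\ (#|FA| * #|FB|)%N = max_can n.
Proof.
pose P := [pred p : {set {set 'I_n}} * {set {set 'I_n}} | cancellative p.1 p.2].
have P0 : (0 < #|P|)%N.
  by apply/card_gt0P; exists ([set finset.set0], [set finset.set0]);
    exact/recovering_cancellative/recovering_points.
have [[FA FB] r E] := bigop.eq_bigmax_cond
  (fun p : {set {set 'I_n}} * {set {set 'I_n}} => #|p.1| * #|p.2|)%N P0.
by exists FA, FB; split; [|rewrite -[RHS]/(\max_(p in P) _)%N E].
Qed.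

Lemma max_rec_supermul m n : (max_rec m * max_rec n <= max_rec (m + n))%N.
Proof.
have [FA [FB [r <-]]] := max_rec_attained m.
have [FA' [FB' [r' <-]]] := max_rec_attained n.
rewrite mulnACA -(card_glue_families FA) -(card_glue_families FB).
by apply: leq_max_rec; exact: recovering_glue.
Qed.

Lemma max_can_gt0 n : (0 < max_can n)%N.
Proof.
apply: leq_trans (leq_max_can (recovering_cancellative (recovering_points n))).
by rewrite !cards1.
Qed.

Section Limits.
Context {R : realType}.
Implicit Types (u : nat -> R) (l : R).

(** The form u n = l n + o(n) that combines well with exponential bounds up to
    subexponential factors. *)
Definition linear_growth u l := forall e : R, 0 < e ->
  exists C : R, forall n : nat, `|u n - l * n%:R| <= e * n%:R + C.

Lemma cvg_growth_rate (a : nat -> nat) l : (forall n, 0 < a n)%N ->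
  linear_growth (fun n => ln (a n)%:R) l ->
  ((fun n => (a n)%:R `^ n%:R^-1) @ \oo --> expR l)%classic.
Proof.
move=> a0 gr.
have cv : ((fun n => n%:R^-1 * ln (a n)%:R : R) @ \oo --> l)%classic.
  apply/cvgrPdist_le => e e0.
  have e2 : 0 < e / 2 by rewrite divr_gt0.
  have [C HC] := gr _ e2.
  near=> n.
  have n0 : 0 < n%:R :> R by rewrite ltr0n; near: n; exact: nbhs_infty_gt.
  have nC : C <= e / 2 * n%:R.
    by rewrite -ler_pdivrMl//; near: n; exact: nbhs_infty_ger.
  rewrite distrC -(ler_pM2r n0).
  have -> : `|n%:R^-1 * ln (a n)%:R - l| * n%:R = `|ln (a n)%:R - l * n%:R|.
    rewrite -[X in _ * X](ger0_norm (ltW n0)) -normrM mulrBl.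
    by rewrite mulrAC mulVf ?mul1r// gt_eqF.
  by have := HC n; move: nC; clear; lra.
have -> : (fun n => (a n)%:R `^ n%:R^-1 : R) =
    (fun n => expR (n%:R^-1 * ln (a n)%:R)).
  by apply/funext => n; rewrite /powR gt_eqF// ltr0n.
by apply: continuous_cvg cv; exact: continuous_expR.
Unshelve. all: by end_near. Qed.

Lemma le_linear (a b C : R) : (forall n : nat, a * n%:R <= b * n%:R + C) -> a <= b.
Proof.
move=> H; rewrite leNgt; apply/negP => ba.
have d0 : 0 < a - b by rewrite subr_gt0.
pose n := Num.bound `|C / (a - b)|.
have : C / (a - b) < n%:R.
  by apply: le_lt_trans (ler_norm _) (archi_boundP (normr_ge0 _)).
rewrite ltr_pdivrMr// => h; have := H n; move: h; clear; lra.
Qed.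

(** Fekete's lemma; l is the supremum of the u n / n. *)
Lemma superadditive_growth u (K : R) : (forall n, 0 <= u n) ->
  (forall m n, u m + u n <= u (m + n)%N) -> (forall n, u n <= K * n%:R) ->
  exists l, linear_growth u l.
Proof.
move=> u0 sup uK.
have usq q m : q%:R * u m <= u (q * m)%N.
  elim: q => [|q IH]; first by rewrite mul0r.
  by rewrite mulSn -natr1 mulrDl mul1r addrC (le_trans _ (sup _ _))// lerD2l.
pose E : set R := fun t => exists2 n, (0 < n)%N & t = u n / n%:R.
have K0 : 0 <= K by have := uK 1%N; rewrite mulr1; apply: le_trans.
have supE : has_sup E.
  split; first by exists (u 1%N / 1%:R); exists 1%N.
  by exists K => _ [n n0 ->]; rewrite ler_pdivrMr// ltr0n.
pose l := reals.sup E.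
have l0 : 0 <= l.
  apply: (@le_trans _ _ (u 1%N / 1%:R)); first by rewrite divr_ge0.
  by apply: ub_le_sup; [case: supE|exists 1%N].
have ul n : u n <= l * n%:R.
  case: n => [|n]; first by have := uK 0%N; rewrite !mulr0.
  rewrite -ler_pdivrMr ?ltr0n//; apply: ub_le_sup; first by case: supE.
  by exists n.+1.
exists l => e e0.
have [_ [m m0 ->] lm] := sup_adherent e0 supE; rewrite -/l in lm.
have mR : 0 < m%:R :> R by rewrite ltr0n.
exists (m%:R * l) => n; rewrite ler_norml; apply/andP; split; last first.
  by have := ul n; have := mulr_ge0 (ltW mR) l0; have : 0 <= e * n%:R
    by [rewrite mulr_ge0// ltW]; clear; lra.
have := usq (n %/ m)%N m.
have h1 : u (n %/ m * m)%N <= u n.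
  by rewrite {2}(divn_eq n m); apply: le_trans (sup _ _); rewrite lerDl.
have h2 : (l - e) * m%:R <= u m by rewrite -ler_pdivlMr// ltW.
have h3 : (n %/ m)%:R * ((l - e) * m%:R) <= (n %/ m)%:R * u m.
  by rewrite ler_wpM2l.
have h4 : n%:R = (n %/ m)%:R * m%:R + (n %% m)%:R :> R.
  by rewrite -natrM -natrD -divn_eq.
have h5 : (n %% m)%:R * l <= m%:R * l.
  by rewrite ler_wpM2r// ler_nat ltnW// ltn_pmod.
have h6 : 0 <= (n %% m)%:R * e by rewrite mulr_ge0// ltW.
have h7 : (l - e) * n%:R = (n %/ m)%:R * ((l - e) * m%:R) + (n %% m)%:R * l - (n %% m)%:R * e.
  by rewrite h4; ring.
move: h1 h3 h5 h6 h7; clear; lra.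
Qed.

Lemma can_growth : linear_growth (fun n => ln (max_can n)%:R) (ln (9 / 4)).
Proof.
move=> e e0; have e2 : 0 < e / 2 by rewrite divr_gt0.
exists (e + `|ln 16| + `|2 * ln (e / 2)|) => n.
have n0 : 0 < (max_can n)%:R :> R by rewrite ltr0n max_can_gt0.
have up : ln (max_can n)%:R <= ln (9 / 4) * n%:R :> R.
  have [FA [FB [c E]]] := max_can_attained n.
  rewrite mulr_natr -lnXn ?divr_gt0// ler_ln ?posrE ?exprn_gt0 ?divr_gt0//.
  by rewrite -E natrM; exact: cancellative_bound.
have [F [c low]] := cancellative_lower n.
have lowM : 9 ^+ n <= (max_can n)%:R * (16 * 4 ^+ n * n.+1%:R ^+ 2) :> R.
  have h : (9 ^ n <= max_can n * (16 * 4 ^ n * n.+1 ^ 2))%N.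
    have -> : (9 ^ n = 3 ^ n * 3 ^ n)%N by rewrite -expnMn.
    apply: leq_trans (leq_mul low low) _.
    have -> : (4 ^ n = 2 ^ n * 2 ^ n)%N by rewrite -expnMn.
    have := leq_max_can c.
    move: (2 ^ n)%N (max_can n) => p M h.
    rewrite (_ : (#|F| * (4 * p * n.+1) * (#|F| * (4 * p * n.+1)))%N =
      ((#|F| * #|F|) * (16 * (p * p) * n.+1 ^ 2))%N); last by lia.
    by rewrite leq_mul2r h orbT.
  by move: h; rewrite -(ler_nat R) !natrM !natrX.
(* the polynomial factor (n + 1)^2 is subexponential *)
have nn : ln n.+1%:R <= e / 2 * n.+1%:R - ln (e / 2) :> R.
  have := @ln_sublinear R (e / 2 * n.+1%:R).
  rewrite lnM ?posrE ?ltr0n// => /(_ _)/ltW.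
  rewrite mulr_gt0 ?ltr0n// => /(_ isT).
  by clear; lra.
have lo : ln (9 / 4) * n%:R <= ln (max_can n)%:R + ln 16 + 2 * ln n.+1%:R :> R.
  have p4 : 0 < 4 ^+ n :> R by rewrite exprn_gt0.
  have p9 : 0 < 9 ^+ n :> R by rewrite exprn_gt0.
  have s0 : 0 < n.+1%:R :> R by rewrite ltr0n.
  have p1 : 0 < n.+1%:R ^+ 2 :> R by rewrite exprn_gt0.
  have p16 : 0 < 16 * 4 ^+ n :> R by rewrite mulr_gt0.
  have p2 := mulr_gt0 p16 p1; have p3 := mulr_gt0 n0 p2.
  have : ln (9 ^+ n) <= ln ((max_can n)%:R * (16 * 4 ^+ n * n.+1%:R ^+ 2)) :> R.
    by rewrite ler_ln ?posrE.
  rewrite (lnM n0 p2) (lnM p16 p1) lnM ?posrE// !lnXn// ln_div ?posrE//.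
  by rewrite mulrBl !mulr_natr mulr2n; clear; lra.
have e1 : ln 16 <= `|ln 16 : R| by exact: ler_norm.
have e3 : - (2 * ln (e / 2)) <= `|2 * ln (e / 2)|.
  by rewrite -normrN; exact: ler_norm.
rewrite ler_norml; apply/andP; split.
  by move: nn lo e1 e3; rewrite -natr1; clear; lra.
apply: (@le_trans _ _ 0); first by rewrite subr_le0.
by rewrite !addr_ge0// ?mulr_ge0// ltW.
Qed.

Lemma rec_growth : exists2 l, linear_growth (fun n => ln (max_rec n)%:R) l & l < ln (9 / 4).
Proof.
have pos n : 0 < (max_rec n)%:R :> R by rewrite ltr0n max_rec_gt0.
have [l gr] : exists l, linear_growth (fun n => ln (max_rec n)%:R) l.
  apply: (@superadditive_growth _ (ln (9 / 4))) => [n|m n|n].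
  - by rewrite ln_ge0// ler1n max_rec_gt0.
  - by rewrite -lnM ?posrE// ler_ln ?posrE ?mulr_gt0// -natrM ler_nat max_rec_supermul.
  - have [FA [FB [r E]]] := max_rec_attained n.
    rewrite mulr_natr -lnXn ?divr_gt0// ler_ln ?posrE ?exprn_gt0 ?divr_gt0//.
    by rewrite -E natrM; exact/cancellative_bound/recovering_cancellative.
exists l => //; have [g g94 gb] := @recovering_bound R.
apply: le_lt_trans g94; apply/ler_addgt0Pr => e e0.
have [C HC] := gr _ e0.
apply: (@le_linear _ _ (2 * ln 2 + C)) => n.
have : ln (max_rec n)%:R <= 2 * ln 2 + n%:R * g :> R.
  have [FA [FB [r E]]] := max_rec_attained n.
  have : (0 < #|FA| * #|FB|)%N by rewrite E max_rec_gt0.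
  by rewrite muln_gt0 -E => /andP[A0 B0]; exact: gb.
have := HC n; rewrite ler_norml => /andP[+ _]; clear; lra.
Qed.

End Limits.

Unset Implicit Arguments.

Theorem mainTheorem2 (R : realType) :
  [/\ cvgn (@can_rate R), cvgn (@rec_rate R),
      mu_rec R < 9 / 4 & 9 / 4 = mu_can R].
Proof.
have p94 : 0 < 9 / 4 :> R by rewrite divr_gt0.
have can := cvg_growth_rate max_can_gt0 (@can_growth R).
have [l gr l94] := @rec_growth R.
have rec := cvg_growth_rate max_rec_gt0 gr.
split.
- by apply: cvgP; exact: can.
- by apply: cvgP; exact: rec.
- rewrite /mu_rec (cvg_lim _ rec)//.
  by rewrite -[ltRHS]lnK ?posrE// ltr_expR.
- by rewrite /mu_can (cvg_lim _ can)// lnK ?posrE.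
Qed.
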